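(* Let $(\bar x,\bar\lambda)=(\bar x^1,\dots,\bar x^N,\bar\lambda^1,\dots,\bar\lambda^N)\in S_{\rm KKT}(\bar p)$. Suppose that: (i) the LICQ holds for each player $k$ at $(\bar p^k,\bar x^k)$; (ii) the SSOSC holds for each player $k$ at $(\bar p^k,\bar x^k,\bar\lambda^k)$; (iii) there exist parameters $\alpha_{i,j}>0$ ($1\le i,j\le N$, $j\ne i$) with $\sum_{j\ne i}\alpha_{i,j}=1$ for $i=1,\dots,N$, such that, with $A_{ki}:=\nabla^2_{x^kx^i}L^k+(\nabla^2_{x^ix^k}L^i)^{\mathrm T}$, for all players $i\neq k$ and any $0\ne y^k\in M^k$, $$(y^k)^{\mathrm T}\left(\nabla^2_{x^kx^k}L^k-\frac{1}{4\alpha_{i,k}\alpha_{k,i}}A_{ik}^{\mathrm T}B^i\left((B^i)^{\mathrm T}\nabla^2_{x^ix^i}L^iB^i\right)^{-1}(B^i)^{\mathrm T}A_{ik}\right)y^k>0 .$$ Then $S_{\rm KKT}$ has a Lipschitz continuous single-valued localization around $\bar p$ for $(\bar x,\bar\lambda)$. Moreover, for every $(p,x(p),\lambda(p))\in{\rm gph}\,S_{\rm KKT}$ sufficiently close to $(\bar p,\bar x,\bar\lambda)$, $x(p)$ is a local Nash equilibrium at $p$.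
   Context: Nash equilibrium problem (NEP) with canonical perturbations. There are $N$ players; player $k$ has strategy $x^k\in\mathbb R^{n_k}$; $x=(x^1,\dots,x^N)\in\mathbb R^n$, $n=n_1+\cdots+n_N$; $x^{-k}$ denotes the other players' strategies. Parameters: $p^k=(u^k,v^k,w^k)\in\mathbb R^{m_k}\times\mathbb R^{n_k}\times\mathbb R^{d_k}$, $p=(p^1,\dots,p^N)$, identified with $(u,v,w)\in\mathbb R^{m}\times\mathbb R^n\times\mathbb R^d$, $m=\sum m_k$, $d=\sum d_k$. Given $x^{-k},p^k$, player $k$ solves the problem $\mathbf P^k(x^{-k},p^k)$: $$\min_{x^k}\ f^k(x^k,x^{-k};w^k)-\langle v^k,x^k\rangle\ \text{ s.t. } g^k_i(x^k;w^k)=u^k_i\ (i=1,\dots,s_k),\ \ g^k_j(x^k;w^k)\le u^k_j\ (j=s_k+1,\dots,m_k),$$ with $f^k\in C^2(\mathbb R^n\times\mathbb R^{d_k})$, $g^k_i\in C^2(\mathbb R^{n_k}\times\mathbb R^{d_k})$. A point $x$ is a local Nash equilibrium (LNE) at $p$ if each $x^k$ is a local minimizer of $\mathbf P^k(x^{-k},p^k)$. Lagrangian: $L^k(x^k,x^{-k},\lambda^k;w^k)=f^k(x^k,x^{-k};w^k)+\sum_{i=1}^{m_k}\lambda^k_ig^k_i(x^k;w^k)$. KKT mapping: $S_{\rm KKT}(p)$ is the set of $(x,\lambda)\in\mathbb R^n\times\mathbb R^m$ such that for each $k$: $v^k=\nabla_{x^k}L^k(x^k,x^{-k},\lambda^k;w^k)$;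 $g^k_i(x^k;w^k)=u^k_i$ for $i\le s_k$; and $\lambda^k_j\ge0$, $g^k_j(x^k;w^k)\le u^k_j$, $\lambda^k_j(g^k_j(x^k;w^k)-u^k_j)=0$ for $j>s_k$. Notation at $(\bar p,\bar x,\bar\lambda)\in{\rm gph}\,S_{\rm KKT}$: $\nabla^2_{x^kx^i}L^k\in\mathbb R^{n_k\times n_i}$ is the matrix of second partials $\partial^2L^k/\partial x^k_a\partial x^i_b$ evaluated at $(\bar x^k,\bar x^{-k},\bar\lambda^k;\bar w^k)$. Index sets: $I^k_1=\{1,\dots,s_k\}\cup\{i\in[s_k+1,m_k]:\bar\lambda^k_i>0=g^k_i(\bar x^k;\bar w^k)-\bar u^k_i\}$, $I^k_2=\{i\in[s_k+1,m_k]:\bar\lambda^k_i=0=g^k_i(\bar x^k;\bar w^k)-\bar u^k_i\}$. $M^k=\{y^k\in\mathbb R^{n_k}:\nabla_{x^k}g^k_i(\bar x^k;\bar w^k)^{\mathrm T}y^k=0\ \forall i\in I^k_1\}$; $B^k\in\mathbb R^{n_k\times(n_k-|I^k_1|)}$ is a matrix whose columns form a basis of $M^k$ (when the LICQ holds). LICQ for player $k$ at $(\bar p^k,\bar x^k)$: the vectors $\nabla_{x^k}g^k_i(\bar x^k;\bar w^k)$, $i\in I^k_1\cup I^k_2$, are linearly independent. SSOSC (strong second-order sufficient condition) for player $k$ at $(\bar p^k,\bar x^k,\bar\lambda^k)$: $(y^k)^{\mathrm T}\nabla^2_{x^kx^k}L^ky^k>0$ for all $0\ne y^k\in M^k$.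 A set-valued mapping $\Phi$ has a Lipschitz continuous single-valued localization around $\bar a$ for $\bar b$ if $\bar b\in\Phi(\bar a)$ and there are neighborhoods $U$ of $\bar a$, $V$ of $\bar b$ such that ${\rm gph}\,\Phi\cap(U\times V)$ is the graph of a Lipschitz continuous single-valued mapping $U\to V$. *)

(* Defs.v *)
From HB Require Import structures.
From mathcomp Require Export all_boot all_order all_algebra.
From mathcomp Require Export all_classical all_reals all_analysis.

Export Order.TTheory GRing.Theory Num.Theory.
Export numFieldNormedType.Exports.

#[export] Set Implicit Arguments.
#[export] Unset Strict Implicit.
#[export] Unset Printing Implicit Defensive.

#[global] Open Scope classical_set_scope.
#[global] Open Scope ring_scope.

(* A vector (x^1, ..., x^N) of R^n, n = n_1 + ... + n_N, is a column vector of
   size \sum_k n k; its block x^k is submxcol x k, and the coordinate x^k_a is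
   the coordinate of x of index tagnat.Rank k a. *)
Notation blockvec R n := 'cV[R]_(\sum_k n k)%N.

Section Calculus.
Variable R : realType.

(* On finite-dimensional spaces this is the usual class C^2. *)
Definition C2 (V : normedModType R) (h : V -> R) : Prop :=
  (forall x, differentiable h x) /\
  forall v, (forall x, differentiable ('D_v h : V -> R) x) /\
    forall w, continuous ('D_w ('D_v h : V -> R) : V -> R).

Definition local_minimizer (V : normedModType R) (F : set V) (h : V -> R)
    (z : V) : Prop :=
  F z /\ \forall y \near z, F y -> h z <= h y.

Definition lipschitz_localization (V W : normedModType R) (Phi : V -> set W)
    (a : V) (b : W) : Prop :=
  Phi a b /\
  exists (A : set V) (B : set W) (h : V -> W),
    [/\ nbhs a A, nbhs b B,
        [set q | Phi q.1 q.2] `&` (A `*` B) = [set q | A q.1 /\ q.2 = h q.1]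
      & [lipschitz h t | t in A] ].

Definition qform r (Q : 'M[R]_r) (y : 'cV[R]_r) : R := (y^T *m Q *m y) 0 0.

End Calculus.

(* cost k is f^k(x^k, x^{-k}; w^k), with arguments (x, w^k); constr k i is
   g^k_i, with arguments (x^k, w^k); num_eq k is s_k: the constraints of index
   i < num_eq k are equalities, the others inequalities. *)
Record nep (R : realType) (N : nat) (n m d : 'I_N -> nat) := Nep {
  num_eq : 'I_N -> nat;
  num_eq_le : forall k, (num_eq k <= m k)%N;
  cost : forall k, blockvec R n * 'cV[R]_(d k) -> R;
  constr : forall k, 'I_(m k) -> 'cV[R]_(n k) * 'cV[R]_(d k) -> R;
  cost_C2 : forall k, C2 (@cost k);
  constr_C2 : forall k i, C2 (@constr k i) }.

Section NEP.
Context {R : realType} {N : nat} {n m d : 'I_N -> nat} (G : nep R n m d).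

(* p = (u, v, w) *)
Local Notation param := (blockvec R m * blockvec R n * blockvec R d)%type.

Definition pu (p : param) k : 'cV[R]_(m k) := submxcol p.1.1 k.
Definition pv (p : param) k : 'cV[R]_(n k) := submxcol p.1.2 k.
Definition pw (p : param) k : 'cV[R]_(d k) := submxcol p.2 k.

(* (z, x^{-k}) *)
Definition deviation (x : blockvec R n) k (z : 'cV[R]_(n k)) : blockvec R n :=
  \mxcol_j eqtype.dfwith (fun j => submxcol x j) z j.

Definition feasible (p : param) k : set 'cV[R]_(n k) :=
  [set z | forall i : 'I_(m k),
    ((i < num_eq G k)%N -> constr G i (z, pw p k) = pu p k i 0) /\
    ((num_eq G k <= i)%N -> constr G i (z, pw p k) <= pu p k i 0)].
Arguments feasible p k z : clear implicits.

Definition objective (p : param) (x : blockvec R n) k (z : 'cV[R]_(n k)) : R :=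
  cost G (deviation x z, pw p k) - \sum_a pv p k a 0 * z a 0.

Definition local_nash (p : param) (x : blockvec R n) : Prop :=
  forall k, local_minimizer (feasible p k) (objective p x (k := k))
                            (submxcol x k).

Definition lagrangian k (lam : 'cV[R]_(m k)) (w : 'cV[R]_(d k))
    (x : blockvec R n) : R :=
  cost G (x, w) + \sum_i lam i 0 * constr G i (submxcol x k, w).

Definition dvar k (a : 'I_(n k)) : blockvec R n := delta_mx (tagnat.Rank k a) 0.

(* grad_{x^k} L^k *)
Definition gradL k (lam : 'cV[R]_(m k)) (w : 'cV[R]_(d k)) (x : blockvec R n) :
    'cV[R]_(n k) :=
  \col_a 'D_(dvar a) (lagrangian lam w) x.

(* grad_{x^k} g^k_i *)
Definition gradg k (i : 'I_(m k)) (w : 'cV[R]_(d k)) (z : 'cV[R]_(n k)) :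
    'cV[R]_(n k) :=
  \col_a 'D_(delta_mx a 0) (fun y => constr G i (y, w)) z.

Definition S_KKT (p : param) : set (blockvec R n * blockvec R m) :=
  [set q | forall k,
    let xk := submxcol q.1 k in
    let lam := submxcol q.2 k in
    pv p k = gradL lam (pw p k) q.1 /\
    forall i : 'I_(m k),
      ((i < num_eq G k)%N -> constr G i (xk, pw p k) = pu p k i 0) /\
      ((num_eq G k <= i)%N ->
         [/\ 0 <= lam i 0, constr G i (xk, pw p k) <= pu p k i 0
           & lam i 0 * (constr G i (xk, pw p k) - pu p k i 0) = 0])].

Section AtReferencePoint.
Variables (p : param) (x : blockvec R n) (lam : blockvec R m).

(* The n_k x n_j matrix of entries d^2 L^l / (d x^k_a d x^j_b). *)
Definition hessL l k j : 'M[R]_(n k, n j) :=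
  \matrix_(a, b) 'D_(dvar a)
    ('D_(dvar b) (lagrangian (submxcol lam l) (pw p l)) : blockvec R n -> R) x.

Definition slack k (i : 'I_(m k)) : R :=
  constr G i (submxcol x k, pw p k) - pu p k i 0.

Definition I1 k : {set 'I_(m k)} :=
  [set i : 'I_(m k) | (i < num_eq G k)%N ||
     [&& (num_eq G k <= i)%N, 0 < submxcol lam k i 0 & slack i == 0]].

Definition I2 k : {set 'I_(m k)} :=
  [set i : 'I_(m k) | [&& (num_eq G k <= i)%N, submxcol lam k i 0 == 0
                        & slack i == 0]].

Definition critM k : set 'cV[R]_(n k) :=
  [set y | forall i, i \in I1 k -> (gradg i (pw p k) (submxcol x k))^T *m y = 0].
Arguments critM k y : clear implicits.

Definition LICQ k : Prop :=
  free [seq gradg i (pw p k) (submxcol x k) | i in I1 k :|: I2 k].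

Definition SSOSC k : Prop :=
  forall y, critM k y -> y != 0 -> 0 < qform (hessL k k k) y.

Definition is_basis_matrix k (B : 'M[R]_(n k, n k - #|I1 k|)) : Prop :=
  let cols := [seq col j B | j : 'I_(n k - #|I1 k|)] in
  free cols /\ critM k = [set y | y \in <<cols>>%VS].

Definition crossA k i : 'M[R]_(n k, n i) := hessL k k i + (hessL i i k)^T.

End AtReferencePoint.
End NEP.

Arguments feasible {R N n m d} G p k z.
Arguments critM {R N n m d} G p x lam k y.

(* Main.v *)
Require Import Defs.
From HB Require Import structures.
From mathcomp Require Import ring lra.

(** Completing the square for each pair of players, the dominance hypothesis
    makes the matrix [(\nabla^2_{x^k x^j} L^k)_{k,j}] positive definite on the
    product of the critical subspaces.  Near the reference point the KKT system
    is then equivalent to [K z = Theta (p, z)], where [K] is the invertible KKT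
    matrix of the strongly active constraints and the weakly active ones enter
    through [lambda = max 0 (lambda + t (g - u))].  For small [t], positive
    definiteness makes [Theta] a contraction in the Euclidean norm of [K z], so
    that its fixed point is unique and Lipschitz in the parameter.

    For the second claim, a Finsler-type lemma gives
    [d^T H d + kappa \sum_i (\nabla g_i d)^2 >= c |d|^2], the sum being over the
    strongly active constraints; near the reference point, for feasible
    directions, the extra term is absorbed by the multipliers, uniformly over
    nearby KKT points. *)

(** * Calculus of C^1 functions *)

(** A weakly active constraint may switch on or off under perturbation, so the KKT system is only
    piecewise smooth and the classical implicit function theorem does not apply. Strict
    differentiability of C^1 data and nonexpansiveness of [Num.max 0] take its place. [K] is
    designed so that the linearization of [Theta] in the unknown [(x, l)] vanishes in every row but
    the weakly active ones, where it is [l + t J x]. When the other rows of [K] vanish, pairing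
    stationarity with [x] turns the cross term [2 t \sum l_i (J x)_i] of the square into
    [- 2 t x^T H x], which is negative; Finsler's lemma makes this quantitative elsewhere, and a
    small [t] beats the remainder in [t^2]. [H] need not be symmetric, since its rows come from
    different Lagrangians.

    For local minimality the obstacle is uniformity: nearby KKT points may have other active sets.
    So curvature and gradients are frozen at the reference point, and only its strongly active
    constraints are penalized. Their multipliers stay positive nearby, so a decrease [s_i] of such a
    constraint contributes the first-order term [l_i s_i], which dominates [2 kappa s_i^2]. *)

Section ContinuouslyDifferentiable.
Variable R : realType.
Implicit Types V W : normedModType R.

(** Shaped so that [C2 f] unfolds to differentiability of [f] together with [C1] for every
    directional derivative of [f]. *)
Definition C1 V (f : V -> R) : Prop :=
  (forall x, differentiable f x) /\ forall v, continuous ('D_v f : V -> R).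

Lemma mean_value_line V (f : V -> R) (x v : V) :
  (forall y, differentiable f y) ->
  exists2 t, 0 < t < 1 & f (x + v) - f x = 'D_v f (x + t *: v).
Proof.
move=> df.
pose line (s : R) : V := x + s *: v.
have E : (fun s : R => f (line s)) = f \o (cst x + *:%R^~ v : R -> V) by [].
have D (s : R) : is_derive s 1 (fun s : R => f (line s)) ('D_v f (line s)).
  have dl : is_diff s (cst x + *:%R^~ v : R -> V) (0 + *:%R^~ v).
    exact: is_diffD.
  have dff : is_diff ((cst x + *:%R^~ v : R -> V) s) f ('d f (line s)).
    exact: differentiableP.
  have d : is_diff s (fun s : R => f (line s)) ('d f (line s) \o (0 + *:%R^~ v)).
    rewrite E; exact: is_diff_comp.
  have dd : differentiable (fun s : R => f (line s)) s by exact: ex_diff.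
  apply: DeriveDef; first exact: diff_derivable.
  by rewrite deriveE// diff_val/= add0r scale1r deriveE.
have cline : {within `[0, 1], continuous (fun s : R => f (line s))}.
  apply: continuous_subspaceT => s.
  by apply: differentiable_continuous; apply/derivable1_diffP; case: (D s).
have [t] := MVT ltr01 (fun s _ => D s) cline.
rewrite in_itv/= subr0 mulr1 /line scale1r scale0r addr0 => t01 e.
by exists t.
Qed.

Lemma mean_value_segment V (f : V -> R) (x v : V) (s : R) :
  (forall y, differentiable f y) ->
  exists2 t, 0 < t < 1 & f (x + s *: v) - f x = s * 'D_v f (x + (t * s) *: v).
Proof.
move=> df; have [t t01 e] := mean_value_line x (s *: v) df.
by exists t => //; rewrite e !deriveE// linearZ/= scalerA.
Qed.

Lemma derive_shift_sub V (f : V -> R) (x v w : V) :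
  (forall y, differentiable f y) ->
  (forall y, differentiable (fun y => f (y + w) - f y) y) /\
  'D_v (fun y => f (y + w) - f y) x = 'D_v f (x + w) - 'D_v f x.
Proof.
move=> df.
have dw y : is_diff y (fun z => f (z + w)) ('d f (y + w)).
  have dl : is_diff y (id \+ cst w : V -> V) (id + 0) by exact: is_diffD.
  have dff : is_diff ((id \+ cst w : V -> V) y) f ('d f (y + w)).
    exact: differentiableP.
  have := @is_diff_comp _ _ _ _ _ _ _ _ _ dl dff.
  by rewrite addr0.
have d y : differentiable (fun z => f (z + w)) y by exact: ex_diff.
split=> [y|]; first by apply: differentiableB.
rewrite (_ : (fun y => _) = (fun y => f (y + w)) - f)//.
rewrite deriveB; [|exact: diff_derivable..].
by rewrite !deriveE// diff_val.
Qed.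

(** Two mean value steps: along [v] for the increment of [h] by [s *: w], then along [w] for the
    derivative of [h] in the direction [v]. *)
Lemma second_difference V (h : V -> R) (x v w : V) (s : R) : C2 h -> 0 < s ->
  exists2 y, `|x - y| <= s * (`|v| + `|w|) &
    h (x + s *: v + s *: w) - h (x + s *: v) - (h (x + s *: w) - h x) =
    s * (s * 'D_w ('D_v h : V -> R) y).
Proof.
move=> [dh C2h] s0.
have [_ _] := derive_shift_sub x v (s *: w) dh.
have dg y := (derive_shift_sub y v (s *: w) dh).1.
have [t t01 ->] := mean_value_segment x v s (dg x).
rewrite (derive_shift_sub _ v (s *: w) dh).2.
have [t' t01' ->] := mean_value_segment (x + (t * s) *: v) w s (C2h v).1.
eexists; last reflexivity.
rewrite -addrA opprD addrA subrr sub0r normrN.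
rewrite (le_trans (ler_normD _ _))//  !normrZ (gtr0_norm s0).
case/andP: t01 => t0 t1; case/andP: t01' => t0' t1'.
rewrite !gtr0_norm// mulrDr lerD// ler_wpM2r// ler_piMl// ltW//.
Qed.

(** The second difference is symmetric in [v] and [w], so it equals [s^2] times either mixed
    derivative, each at some point near [x]; continuity of both concludes. *)
Lemma schwarz V (h : V -> R) (x v w : V) : C2 h ->
  'D_v ('D_w h : V -> R) x = 'D_w ('D_v h : V -> R) x.
Proof.
move=> C2h; have [dh dC2] := C2h.
apply/eqP; rewrite -subr_eq0 -normr_eq0; apply/eqP/le_anti.
rewrite normr_ge0 andbT; apply/ler_addgt0Pl => e e0; rewrite addr0.
have e20 : 0 < e / 2 by rewrite divr_gt0.
have /cvgrPdist_le/(_ _ e20) c1 := (dC2 w).2 v x.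
have /cvgrPdist_le/(_ _ e20) c2 := (dC2 v).2 w x.
have /nbhs_ballP[r /= r0 br] : \forall y \near x,
    `|'D_v ('D_w h : V -> R) x - 'D_v ('D_w h : V -> R) y| <= e / 2 /\
    `|'D_w ('D_v h : V -> R) x - 'D_w ('D_v h : V -> R) y| <= e / 2.
  exact: (filterI c1 c2).
have M0 : 0 < `|v| + `|w| + 1 by rewrite ltr_wpDl// addr_ge0.
(* This step size keeps both intermediate points in the ball of radius [r]; the [+ 1] covers
   [v = w = 0]. *)
pose s := r / (`|v| + `|w| + 1).
have s0 : 0 < s by rewrite divr_gt0.
have sr : s * (`|v| + `|w|) < r.
  by rewrite /s -mulrA gtr_pMr// mulrC ltr_pdivrMr// mul1r ltrDl.
have [y yx] := second_difference x v w C2h s0.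
have [z zx] := second_difference x w v C2h s0.
rewrite (addrAC x (s *: w)) => ez.
have E : h (x + s *: v + s *: w) - h (x + s *: v) - (h (x + s *: w) - h x) =
   h (x + s *: v + s *: w) - h (x + s *: w) - (h (x + s *: v) - h x) by ring.
rewrite E ez => /(mulfI (lt0r_neq0 s0))/(mulfI (lt0r_neq0 s0)) exy.
have [|bz _] := br z.
  rewrite -ball_normE/=; apply: le_lt_trans sr.
  by rewrite [`|v| + _]addrC.
have [|_ by_] := br y.
  by rewrite -ball_normE/=; exact: le_lt_trans sr.
rewrite exy in bz.
rewrite distrC in by_.
set a := 'D_v ('D_w h) x in bz *; set b := 'D_w ('D_v h) x in by_ *.
rewrite (_ : a - b = (a - 'D_w ('D_v h) y) + ('D_w ('D_v h) y - b)); last first.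
  by rewrite addrA subrK.
rewrite (splitr e); exact: (le_trans (ler_normD _ _) (lerD bz by_)).
Qed.

(** A finite spanning family with coordinates bounded by the norm. Neither independence nor
    linearity of the coordinates is asked for, and the constant one fits sup norms, so products of
    column spaces qualify directly. *)
Definition finite_dim V : Prop :=
  exists r (e : 'I_r -> V) (c : 'I_r -> V -> R),
    (forall v, v = \sum_i c i v *: e i) /\ forall i v, `|c i v| <= `|v|.

Lemma mx_entry_le m n (A : 'M[R]_(m, n)) i j : `|A i j| <= `|A|.
Proof.
rewrite [leRHS]/Num.norm /= mx_normrE.
by apply/bigmax_geP; right => /=; exists (i, j).
Qed.

Lemma finite_dim_cV n : finite_dim 'cV[R]_n.
Proof.
exists n, (fun i => delta_mx i 0), (fun i (v : 'cV[R]_n) => v i 0); split=> [v|i v].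
  by rewrite {1}[v]matrix_sum_delta; apply: eq_bigr => i _; rewrite big_ord1.
exact: mx_entry_le.
Qed.

Lemma finite_dim_prod V W : finite_dim V -> finite_dim W ->
  finite_dim (V * W)%type.
Proof.
move=> [r [e [c [ec cle]]]] [s [f [d [fd dle]]]].
exists (r + s)%N.
exists (fun i : 'I_(r + s) => match fintype.split i with inl j => (e j, 0) | inr j => (0, f j) end).
exists (fun (i : 'I_(r + s)) (v : V * W) =>
  match fintype.split i with inl j => c j v.1 | inr j => d j v.2 end).
split=> [[v w]|i [v w]]; last first.
  by case: (fintype.split i) => j/=; rewrite [leRHS]prod_normE le_max ?cle ?dle ?orbT.
rewrite big_split_ord/=.
under eq_bigr do rewrite (unsplitK (inl _)).
under [X in _ + X]eq_bigr do rewrite (unsplitK (inr _)).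
rewrite [RHS]surjective_pairing; congr (_, _).
  rewrite [RHS]/(_ + _) !(big_morph fst (fun _ _ => erefl) erefl)/= -ec.
  rewrite big1 => [|i _]; first by rewrite [RHS]addr0.
  exact: scaler0.
rewrite [RHS]/(_ + _) !(big_morph snd (fun _ _ => erefl) erefl)/= -fd.
rewrite big1 => [|i _]; first by rewrite [RHS]add0r.
exact: scaler0.
Qed.

(** Strict differentiability: the mean value point lies on the segment between the two arguments,
    hence in the ball around [a], where every partial derivative is close to its value at [a]. *)
Lemma C1_strict V (f : V -> R) (a : V) (e : R) : finite_dim V -> C1 f -> 0 < e ->
  \forall q \near (a, a),
    `|f q.1 - f q.2 - 'd f a (q.1 - q.2)| <= e * `|q.1 - q.2|.
Proof.
move=> [r [b [c [bc cle]]]] [df cf] e0.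
(* An equal share of [e] for each of the [r] partial derivatives; the successor avoids dividing by
   zero when [r = 0]. *)
have er0 : 0 < e / r.+1%:R by rewrite divr_gt0.
have : \forall y \near a, forall i,
    `|'D_(b i) f a - 'D_(b i) f y| <= e / r.+1%:R.
  apply: filter_forall => i.
  by have /cvgrPdist_le/(_ _ er0) := cf (b i) a.
move=> /nbhs_ballP[d /= d0 bd].
exists (ball a d, ball a d); first by split; apply: nbhsx_ballx.
move=> [x y] /= [ax ay].
have [t /andP[t0 t1]] := mean_value_line y (x - y) df.
rewrite (addrC y (x - y)) subrK => ->.
have /bd bdt : ball a d (y + t *: (x - y)).
  move: ax ay; rewrite -!ball_normE/= => ax ay.
  rewrite (_ : a - _ = t *: (a - x) + (1 - t) *: (a - y)); last first.
    rewrite scalerBl scale1r addrCA -scalerBr opprB (addrC (a - x)) subrKA.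
    by rewrite opprD addrA -scalerN opprB.
  have t1' : 0 < 1 - t by rewrite subr_gt0.
  rewrite (le_lt_trans (ler_normD _ _))// !normrZ !gtr0_norm//.
  by rewrite [ltRHS](_ : d = t * d + (1 - t) * d) ?ltrD ?ltr_pM2l//; ring.
have E (l : {linear V -> R}) z : l z = \sum_i c i z * l (b i).
  by rewrite {1}(bc z) linear_sum; apply: eq_bigr => i _; rewrite linearZ.
rewrite deriveE// (E _ (x - y)) (E ('d f a) (x - y)) -sumrB.
under eq_bigr do rewrite -mulrBr.
rewrite (le_trans (ler_norm_sum _ _ _))//.
apply: (@le_trans _ _ (\sum_(i < r) `|x - y| * (e / r.+1%:R))).
  apply: ler_sum => i _; rewrite normrM ler_pM// distrC -!deriveE//; exact: bdt.
rewrite sumr_const card_ord -(mulr_natr _ r) -mulrA mulrC ler_wpM2r//.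
by rewrite mulrAC ler_pdivrMr// ler_pM2l// ler_nat.
Qed.

Lemma C1D V (f g : V -> R) : C1 f -> C1 g -> C1 (fun x => f x + g x).
Proof.
move=> [df cf] [dg cg]; rewrite -[fun x => _]/(f + g).
split=> [x|v x]; first exact: differentiableD.
rewrite (_ : 'D_v (f + g) = fun x => 'D_v f x + 'D_v g x); last first.
  by apply/funext => y; rewrite deriveD//; exact: diff_derivable.
exact: (cvgD (cf v x) (cg v x)).
Qed.

Lemma C1N V (f : V -> R) : C1 f -> C1 (fun x => - f x).
Proof.
move=> [df cf]; rewrite -[fun x => _]/(- f).
split=> [x|v x]; first exact: differentiableN.
rewrite (_ : 'D_v (- f) = fun x => - 'D_v f x); last first.
  by apply/funext => y; rewrite deriveN//; exact: diff_derivable.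
exact: (cvgN (cf v x)).
Qed.

Lemma C1M V (f g : V -> R) : C1 f -> C1 g -> C1 (fun x => f x * g x).
Proof.
move=> [df cf] [dg cg]; rewrite -[fun x => _]/(f * g).
split=> [x|v x]; first exact: differentiableM.
rewrite (_ : 'D_v (f * g) = fun x => f x * 'D_v g x + g x * 'D_v f x); last first.
  by apply/funext => y; rewrite deriveM//; exact: diff_derivable.
have cont (h : V -> R) : (forall x, differentiable h x) -> continuous h.
  by move=> dh y; exact: differentiable_continuous.
exact: (cvgD (cvgM (cont f df x) (cg v x)) (cvgM (cont g dg x) (cf v x))).
Qed.

Lemma C1_cst V (c : R) : C1 (fun _ : V => c).
Proof.
split=> [x|v x]; first exact: differentiable_cst.
rewrite (_ : 'D_v _ = fun=> 0); first exact: cst_continuous.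
by apply/funext => y; rewrite derive_cst.
Qed.

Lemma C1_sum V (I : Type) (s : seq I) (P : pred I) (f : I -> V -> R) :
  (forall i, P i -> C1 (f i)) -> C1 (fun x => \sum_(i <- s | P i) f i x).
Proof.
move=> Cf; elim: s => [|i s IH].
  rewrite (_ : (fun x => _) = fun=> 0); first exact: C1_cst.
  by apply/funext => x; rewrite big_nil.
rewrite (_ : (fun x => _) = fun x => (if P i then f i x else 0) +
    \sum_(j <- s | P j) f j x).
  by apply: C1D IH; case Pi: (P i); [exact: Cf|exact: C1_cst].
by apply/funext => x; rewrite big_cons; case: ifP; rewrite ?add0r.
Qed.

Lemma C1_comp_linear V W (l : {linear V -> W}) (f : W -> R) :
  continuous l -> C1 f -> C1 (fun x => f (l x)).
Proof.
move=> cl [df cf]; split=> [x|v x].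
  by apply: differentiable_comp => //; exact: linear_differentiable.
rewrite (_ : 'D_v _ = fun y => 'D_(l v) f (l y)); last first.
  apply/funext => y; rewrite /derive; set d := (fun _ : R => _).
  set d' := (fun _ : R => _); suff -> : d = d' by [].
  by apply/funext => h; rewrite /d /d' /= linearP.
exact: (@continuous_comp _ _ _ l ('D_(l v) f) x (cl x) (cf (l v) (l x))).
Qed.

Lemma C1_linear V (l : {linear V -> R}) : continuous l -> C1 l.
Proof.
move=> cl; split=> [x|v x]; first exact: linear_differentiable.
rewrite (_ : 'D_v _ = fun=> l v); first exact: cst_continuous.
by apply/funext => y; rewrite deriveE ?diff_lin//; exact: linear_differentiable.
Qed.

Lemma C1_continuous V (f : V -> R) : C1 f -> continuous f.
Proof. by move=> [df _] x; exact: differentiable_continuous. Qed.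

Lemma near_lt_cont V (f g : V -> R) (w : V) (Cf : C1 f)
  (Cg : C1 g) : f w < g w -> \forall x \near w, f x < g x.
Proof.
rewrite -subr_lt0 => lt0.
have C : C1 (fun x => f x - g x) by exact: (C1D Cf (C1N Cg)).
have cC : continuous (fun x => f x - g x) by exact: C1_continuous.
have := cC w.
move=> /cvgr_lt/(_ 0 lt0); apply: filterS => x /=; by rewrite subr_lt0.
Qed.

End ContinuouslyDifferentiable.

(** * Euclidean norm and Finsler lemma *)

Section Euclid.
Variable R : realType.

Lemma mx_norm_le m n (A : 'M[R]_(m, n)) (c : R) : 0 <= c ->
  (forall i j, `|A i j| <= c) -> `|A| <= c.
Proof.
move=> c0 Ac; rewrite [leLHS]/Num.norm /= mx_normrE.
by apply/bigmax_leP; split=> // -[i j] _; exact: Ac.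
Qed.

(** The norm [|v|] of a column is the sup norm. The contraction estimate expands squares, so it
    needs the Euclidean norm as well. *)
Definition enorm r (v : 'cV[R]_r) : R := Num.sqrt (\sum_i v i 0 ^+ 2).

Variable r : nat.
Implicit Types u v w : 'cV[R]_r.

Lemma sumsq_ge0 v : 0 <= \sum_i v i 0 ^+ 2.
Proof. by apply: sumr_ge0 => i _; exact: sqr_ge0. Qed.

Lemma enorm_ge0 v : 0 <= enorm v. Proof. exact: sqrtr_ge0. Qed.

Lemma sqr_enorm v : enorm v ^+ 2 = \sum_i v i 0 ^+ 2.
Proof. by rewrite sqr_sqrtr// sumsq_ge0. Qed.

Lemma enorm_le u v : (forall i, `|u i 0| <= `|v i 0|) -> enorm u <= enorm v.
Proof.
move=> uv; rewrite ler_wsqrtr//; apply: ler_sum => i _.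
by rewrite -(real_normK (num_real (u i 0))) -(real_normK (num_real (v i 0)))
  lerXn2r ?nnegrE.
Qed.

Lemma enormN v : enorm (- v) = enorm v.
Proof.
by congr Num.sqrt; apply: eq_bigr => i _; rewrite mxE sqrrN.
Qed.

Lemma norm_le_enorm v : `|v| <= enorm v.
Proof.
apply: mx_norm_le; first exact: enorm_ge0.
move=> i j; rewrite (ord1 j) -sqrtr_sqr ler_wsqrtr//.
by rewrite (bigD1 i)//= lerDl sumr_ge0// => k _; exact: sqr_ge0.
Qed.

(** The crude constant [r + 1] in place of the square root of [r] is positive even for [r = 0], so
    it can be divided by later. *)
Lemma enorm_le_norm v : enorm v <= r.+1%:R * `|v|.
Proof.
rewrite -[leRHS]ger0_norm ?mulr_ge0// -sqrtr_sqr ler_wsqrtr//.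
apply: (@le_trans _ _ (\sum_(i < r) `|v| ^+ 2)).
  apply: ler_sum => i _; rewrite -(real_normK (num_real (v i 0))).
  by rewrite lerXn2r ?nnegrE// mx_entry_le.
rewrite sumr_const card_ord -(mulr_natl _ r) exprMn ler_wpM2r ?sqr_ge0//.
by rewrite -natrX ler_nat (leq_trans (leqnSn r))// -mulnn leq_pmulr.
Qed.

Lemma cauchy_schwarz u v : \sum_i u i 0 * v i 0 <= enorm u * enorm v.
Proof.
have := sqr_enorm u; have := sqr_enorm v.
have := enorm_ge0 u; have := enorm_ge0 v.
set a := enorm u; set b := enorm v; set c := \sum_i _ * _ => b0 a0 eb ea.
(* This is the expansion of the sum of squares of [b^2 u_i - c v_i], with [a], [b] the two norms and
   [c] the inner product. *)
have key : 0 <= b ^+ 2 * (a ^+ 2 * b ^+ 2 - c ^+ 2).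
  have : 0 <= \sum_i (b ^+ 2 * u i 0 - c * v i 0) ^+ 2.
    by apply: sumr_ge0 => i _; exact: sqr_ge0.
  under eq_bigr => i _.
    rewrite (_ : _ ^+ 2 = b ^+ 4 * u i 0 ^+ 2 - 2 * b ^+ 2 * c * (u i 0 * v i 0)
       + c ^+ 2 * v i 0 ^+ 2); last by ring.
    over.
  rewrite big_split/= sumrB -!mulr_sumr -ea -eb -/c.
  by congr (_ <= _); ring.
have [b_eq0|b_gt0] : b = 0 \/ 0 < b by case: ltrgt0P b0; [right|by []|left].
  rewrite b_eq0 mulr0 /c big1// => i _.
  suff -> : v i 0 = 0 by rewrite mulr0.
  apply: normr0_eq0; apply/le_anti; rewrite normr_ge0 andbT -b_eq0 (le_trans _ (norm_le_enorm v))//.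
  exact: mx_entry_le.
move: key; rewrite pmulr_rge0 ?exprn_gt0// subr_ge0 -exprMn => key.
rewrite (le_trans (ler_norm _))// -ler_sqr ?nnegrE ?mulr_ge0//.
by rewrite real_normK ?num_real.
Qed.

Lemma enormD u v : enorm (u + v) <= enorm u + enorm v.
Proof.
rewrite -ler_sqr ?nnegrE ?addr_ge0 ?enorm_ge0// sqr_enorm.
under eq_bigr do rewrite mxE sqrrD.
rewrite !big_split -!sqr_enorm sqrrD lerD2r lerD2l.
by rewrite -[leLHS]mulr2n lerMn2r cauchy_schwarz.
Qed.

Lemma enormB_le u v : `|enorm u - enorm v| <= enorm (u - v).
Proof.
rewrite ler_norml; apply/andP; split.
  rewrite lerNl opprB lerBlDr -(enormN (u - v)) opprB.
  by rewrite (le_trans _ (enormD _ _))// subrK.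
by rewrite lerBlDr (le_trans _ (enormD _ _))// subrK.
Qed.

Lemma enorm0 : enorm (0 : 'cV[R]_r) = 0.
Proof.
by rewrite /enorm big1 ?sqrtr0// => i _; rewrite mxE expr0n.
Qed.

Lemma enorm_le0 v : enorm v <= 0 -> v = 0.
Proof.
by move=> v0; apply/normr0_eq0/le_anti; rewrite normr_ge0 (le_trans (norm_le_enorm v)).
Qed.

End Euclid.

Section Linear.
Variable R : realType.

Lemma linear_bounded_ex (V W : normedModType R) (l : V -> W) :
  finite_dim V -> linear l ->
  exists2 C, 0 <= C & forall v, `|l v| <= C * `|v|.
Proof.
move=> [r [b [c [bc cle]]]] ll.
pose L : {linear V -> W} := HB.pack l (GRing.isLinear.Build R V W *:%R l ll).
exists (\sum_i `|l (b i)|); first exact: sumr_ge0.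
move=> v; rewrite {1}(bc v) -[l]/(L : V -> W) linear_sum mulr_suml.
rewrite (le_trans (ler_norm_sum _ _ _))// ler_sum// => i _.
by rewrite linearZ/= normrZ mulrC ler_wpM2l.
Qed.

Lemma lipschitz_continuous (V W : normedModType R) (f : V -> W) (C : R) :
  0 <= C -> (forall x y, `|f x - f y| <= C * `|x - y|) -> continuous f.
Proof.
move=> C0 lf x; apply/cvgrPdist_le => e e0.
have C1 : 0 < C + 1 by rewrite ltr_wpDl.
apply/nbhs_ballP; exists (e / (C + 1)) => /=; first by rewrite divr_gt0.
move=> y; rewrite -ball_normE/= ltr_pdivlMr// => xy.
rewrite (le_trans (lf _ _))// (le_trans _ (ltW xy))// mulrC ler_wpM2l//.
by rewrite lerDl.
Qed.

Lemma linear_cont (V W : normedModType R) (l : V -> W) :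
  finite_dim V -> linear l -> continuous l.
Proof.
move=> fV ll; have [C C0 lC] := linear_bounded_ex fV ll.
pose L : {linear V -> W} := HB.pack l (GRing.isLinear.Build R V W *:%R l ll).
apply: (lipschitz_continuous C0) => x y.
by rewrite -[l]/(L : V -> W) -linearB; exact: lC.
Qed.

Lemma C1_lin (V : normedModType R) (l : V -> R) :
  finite_dim V -> linear l -> C1 l.
Proof.
move=> fV ll.
pose L : {linear V -> R} := HB.pack l (GRing.isLinear.Build R V R *:%R l ll).
exact: (@C1_linear _ _ L (linear_cont fV ll)).
Qed.

Lemma C1_comp_lin (V W : normedModType R) (l : V -> W) (f : W -> R) :
  finite_dim V -> linear l -> C1 f -> C1 (fun x => f (l x)).
Proof.
move=> fV ll.
pose L : {linear V -> W} := HB.pack l (GRing.isLinear.Build R V W *:%R l ll).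
exact: (@C1_comp_linear _ _ _ L _ (linear_cont fV ll)).
Qed.

(** Heine-Borel is applied to row vectors and carried over by transposition, an isometry of the sup
    norms. *)
Lemma compact_cV r (A : set 'cV[R]_r) (M : R) : closed A ->
  (forall v, A v -> `|v| <= M) -> compact A.
Proof.
move=> cA bA.
pose T := @trmx R 1 r.
have TN v : `|T v| = `|v|.
  apply/le_anti/andP; split; apply: mx_norm_le => // i j.
    by rewrite mxE mx_entry_le.
  by have := mx_entry_le (T v) j i; rewrite mxE.
have cT : continuous T.
  apply: (@lipschitz_continuous _ _ T 1) => // x y.
  by rewrite mul1r -linearB TN.
have -> : A = T @` (T @^-1` A).
  apply/seteqP; split=> [v Av|_ [v Av <-]//].
  by exists v^T; rewrite /= /T trmxK.
apply: continuous_compact; first exact: continuous_subspaceT.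
apply: bounded_closed_compact.
  exists M; split; first exact: num_real.
  by move=> x Mx v /bA; rewrite TN => /le_trans; apply; exact: ltW.
by apply: preimage_closed => // x _; exact: cT.
Qed.

Section Finsler.
Variable r : nat.

(** The constant is the minimum of [f] on the compact unit sphere; homogeneity extends the bound to
    all vectors. *)
Lemma quadratic_coercive (f : 'cV[R]_r -> R) : continuous f ->
  (forall a y, f (a *: y) = a ^+ 2 * f y) ->
  (forall y, y != 0 -> 0 < f y) ->
  exists2 c, 0 < c & forall y, c * `|y| ^+ 2 <= f y.
Proof.
move=> cf fZ f0.
have f00 : f 0 = 0 by rewrite -(scale0r 0) fZ expr0n mul0r.
have cN : continuous (fun y : 'cV[R]_r => `|y|).
  by move=> x; exact: norm_continuous.
have cS : compact [set y : 'cV[R]_r | `|y| = 1].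
  apply: (@compact_cV _ _ 1) => [|v /= ->//].
  apply: (@preimage_closed _ _ (fun y : 'cV[R]_r => `|y|) [set (1:R)]) => [y _|].
    exact: cN.
  exact: closed_eq.
have [S0|/nonemptyPn S0] := pselect ([set y : 'cV[R]_r | `|y| = 1] !=set0).
  have [y yS ymin] := compact_EVT_min S0 cS (continuous_subspaceT cf).
  have y0 : y != 0.
    by move: yS; rewrite inE/= => y1; rewrite -normr_eq0 y1 oner_eq0.
  exists (f y); first exact: f0.
  move=> z; have [->|z0] := eqVneq z 0.
    by rewrite f00 normr0 expr0n mulr0.
  have nz : 0 < `|z| by rewrite normr_gt0.
  rewrite -[z in leRHS](@scalerKV _ _ `|z|) ?gt_eqF// fZ mulrC ler_wpM2l ?sqr_ge0//.
  by apply: ymin; rewrite inE/= normrZ normfV normr_id mulVf// gt_eqF.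
(* If the unit sphere is empty, every vector is zero and any positive constant serves. *)
exists 1 => // z; have [->|z0] := eqVneq z 0.
  by rewrite f00 normr0 expr0n mulr0.
have nz : 0 < `|z| by rewrite normr_gt0.
suff : [set y : 'cV[R]_r | `|y| = 1] (`|z|^-1 *: z) by rewrite S0.
by rewrite /= normrZ normfV normr_id mulVf// gt_eqF.
Qed.

(** On the compact part of the sphere where [q <= 0], the function [s] cannot vanish, so it has a
    positive minimum there and a large multiple of it outweighs [q]. Homogeneity of degree two is
    all that is asked of [q] and [s], so the lemma serves both for the KKT forms and for the Hessian
    of one player. *)
Lemma finsler (q s : 'cV[R]_r -> R) : continuous q -> continuous s ->
  (forall a y, q (a *: y) = a ^+ 2 * q y) ->
  (forall a y, s (a *: y) = a ^+ 2 * s y) ->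
  (forall y, 0 <= s y) ->
  (forall y, y != 0 -> s y = 0 -> 0 < q y) ->
  exists k c : R, [/\ 0 <= k, 0 < c &
    forall y, c * `|y| ^+ 2 <= q y + k * s y].
Proof.
move=> cq cs qZ sZ s0 qs.
suff [k k0 kP] : exists2 k, 0 <= k & forall y, y != 0 -> 0 < q y + k * s y.
  have [||c c0 cP] := @quadratic_coercive (fun y => q y + k * s y) _ _ kP.
  - by move=> y; exact: (cvgD (cq y) (cvgM (cvg_cst k) (cs y))).
  - by move=> a y; rewrite qZ sZ; ring.
  by exists k, c.
pose S := [set y : 'cV[R]_r | `|y| = 1].
have cS : closed S.
  apply: (@preimage_closed _ _ (fun y : 'cV[R]_r => `|y|) [set (1:R)]) => [y _|].
    exact: norm_continuous.
  exact: closed_eq.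
have kS : compact S by apply: (@compact_cV _ _ 1) => [//|v /= ->].
pose T := S `&` [set y | q y <= 0].
have kT : compact T.
  apply: (@compact_cV _ _ 1) => [|v [/= ->]//].
  apply: closedI => //; apply: (@preimage_closed _ _ q [set x : R | x <= 0]) => [y _|].
    exact: cq.
  exact: closed_le.
have unit (y : 'cV[R]_r) : y != 0 -> S (`|y|^-1 *: y).
  by move=> y0; rewrite /S/= normrZ normfV normr_id mulVf// normr_eq0.
have S_neq0 y : S y -> y != 0.
  by rewrite /S/= => y1; rewrite -normr_eq0 y1 oner_eq0.
have scale (k : R) y : y != 0 -> q y + k * s y =
    `|y| ^+ 2 * (q (`|y|^-1 *: y) + k * s (`|y|^-1 *: y)).
  move=> y0; rewrite qZ sZ exprVn.
  have : `|y| != 0 by rewrite normr_eq0.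
  by move=> ?; field.
suff [k k0 kP] : exists2 k, 0 <= k & forall y, S y -> 0 < q y + k * s y.
  exists k => // y y0; rewrite scale// mulr_gt0 ?exprn_gt0 ?normr_gt0//.
  exact/kP/unit.
have [T0|/nonemptyPn T0] := pselect (T !=set0); last first.
  exists 0 => // y Sy; rewrite mul0r addr0 ltNge; apply/negP => qy.
  by suff : T y by rewrite T0.
have S0 : S !=set0 by case: T0 => y [Sy _]; exists y.
have [y yT ymin] := compact_EVT_min T0 kT (continuous_subspaceT cs).
have [z zS zmin] := compact_EVT_min S0 kS (continuous_subspaceT cq).
have sy0 : 0 < s y.
  move: yT; rewrite inE => -[/S_neq0 y0 /= qy].
  rewrite lt_neqAle s0 andbT eq_sym; apply/eqP => /(qs _ y0).
  by rewrite ltNge qy.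
(* [q z] is the minimum of [q] on the sphere and [s y] that of [s] where [q <= 0]; there the penalty
   is at least [|q z| + 1], which exceeds [- q]. *)
exists ((`|q z| + 1) / s y) => [|x Sx]; first by rewrite divr_ge0// addr_ge0.
have [qx|qx] := ltP 0 (q x).
  by rewrite ltr_wpDr// mulr_ge0// divr_ge0// addr_ge0.
have : s y <= s x by apply: ymin; rewrite inE.
rewrite -(ler_pM2l (_ : 0 < (`|q z| + 1) / s y)); last first.
  by rewrite divr_gt0// ltr_wpDl.
rewrite divfK ?gt_eqF//.
have : q z <= q x by apply: zmin; rewrite inE.
have := ler_norm (- q z); rewrite normrN.
set A := _ / _ * s x; lra.
Qed.

End Finsler.
End Linear.

(** * Localization of fixed points *)

Section Localization.
Variable R : realType.
Implicit Types V W : normedModType R.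

Lemma lipschitz_within V W (A : set V) (f : V -> W) (C : R) :
  0 <= C -> (forall x y, A x -> A y -> `|f x - f y| <= C * `|x - y|) ->
  {within A, continuous f}.
Proof.
move=> C0 lf; apply/subspace_continuousP => x Ax; apply/cvgrPdist_le => e e0.
have C1 : 0 < C + 1 by rewrite ltr_wpDl.
apply/nbhs_ballP; exists (e / (C + 1)) => /=; first by rewrite divr_gt0.
move=> y; rewrite -ball_normE/= ltr_pdivlMr// => xy Ay.
rewrite (le_trans (lf _ _ Ax Ay))// (le_trans _ (ltW xy))// mulrC ler_wpM2l//.
by rewrite lerDl.
Qed.

Lemma compact_enorm_ball r (c : 'cV[R]_r) (s : R) :
  compact [set z : 'cV[R]_r | enorm (z - c) <= s].
Proof.
apply: (@compact_cV _ _ _ (s + `|c|)) => [|z /= zc]; last first.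
  rewrite -[z](subrK c) (le_trans (ler_normD _ _))// lerD2r.
  by rewrite (le_trans (norm_le_enorm _)).
apply: (@preimage_closed _ _ (fun z : 'cV[R]_r => enorm (z - c)) [set x : R | x <= s]).
  move=> z _; apply: (@lipschitz_continuous _ _ _ _ r.+1%:R) => // x y.
  rewrite (le_trans (enormB_le _ _))// (le_trans (enorm_le_norm _))//.
  by rewrite opprB addrA subrK.
exact: closed_le.
Qed.

(* The displacement [z |-> |z - T z|] attains its minimum on the compact ball,
   and [T] strictly decreases a positive displacement. *)
Lemma enorm_contraction_fixpoint r (T : 'cV[R]_r -> 'cV[R]_r) (c : 'cV[R]_r)
    (rho s : R) : 0 <= s -> 0 <= rho < 1 ->
  (forall z z', enorm (z - c) <= s -> enorm (z' - c) <= s ->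
     enorm (T z - T z') <= rho * enorm (z - z')) ->
  enorm (T c - c) <= (1 - rho) * s ->
  exists2 z, enorm (z - c) <= s & T z = z.
Proof.
move=> s0 /andP[rho0 rho1] Tlip Tc.
pose B := [set z | enorm (z - c) <= s].
have Bc : B c by rewrite /B/= subrr enorm0.
have TB z : B z -> B (T z).
  move=> Bz; rewrite /B/= -(subrK (T c) (T z)) -addrA.
  rewrite (le_trans (enormD _ _))//.
  have := Tlip _ _ Bz Bc; have : rho * enorm (z - c) <= rho * s by rewrite ler_wpM2l.
  lra.
have B0 : B !=set0 by exists c.
have cf : {within B, continuous (fun z => enorm (z - T z))}.
  apply: (@lipschitz_within _ _ _ _ (2 * r.+1%:R)) => // x y Bx By.
  rewrite (le_trans (enormB_le _ _))//.
  rewrite (_ : _ - _ = (x - y) + - (T x - T y)); last first.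
    by rewrite !opprB (addrC (T y) (- y)) addrACA (addrC (T y)).
  rewrite (le_trans (enormD _ _))// enormN -mulrA (le_trans (lerD (lexx _) (Tlip _ _ Bx By)))//.
  rewrite mulr_natl mulr2n lerD// ?enorm_le_norm//.
  rewrite (le_trans _ (enorm_le_norm _))// ler_piMl ?enorm_ge0 ?ltW//.
have [z + zmin] := compact_EVT_min B0 (@compact_enorm_ball r c s) cf.
rewrite inE => Bz; exists z => //.
have : enorm (z - T z) <= enorm (T z - T (T z)) by apply: zmin; rewrite inE; exact: TB.
move=> /le_trans/(_ (Tlip _ _ Bz (TB _ Bz))) zz.
have /enorm_le0/subr0_eq// : enorm (z - T z) <= 0.
have := enorm_ge0 (z - T z); rewrite -subr_ge0 in zz.
rewrite -(pmulr_rle0 _ (_ : 0 < 1 - rho)) ?subr_gt0//; lra.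
Qed.

(** For fixed [p], the map [Th p] read in the coordinates [y = K z] is a contraction near [K b].
    Existence comes from its fixed point; uniqueness and Lipschitz dependence both come from
    [(1 - rho) |K (z - z')| <= C |p - p'|], with the Euclidean norm on the left. *)
Lemma contraction_localization V W r (Phi : V -> set W) (a : V) (b : W)
    (K : W -> 'cV[R]_r) (Ki : 'cV[R]_r -> W) (Th : V -> W -> 'cV[R]_r)
    (rho C D : R) :
  linear K -> cancel Ki K -> cancel K Ki ->
  0 < D -> (forall z, `|K z| <= D * `|z|) -> (forall z, `|z| <= D * `|K z|) ->
  0 <= rho < 1 -> 0 < C ->
  (\forall q \near ((a, b), (a, b)),
     enorm (Th q.1.1 q.1.2 - Th q.2.1 q.2.2) <=
     rho * enorm (K (q.1.2 - q.2.2)) + C * `|q.1.1 - q.2.1|) ->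
  Phi a b ->
  (\forall q \near (a, b), Phi q.1 q.2 <-> K q.2 = Th q.1 q.2) ->
  lipschitz_localization Phi a b.
Proof.
move=> lK KiK KKi D0 Kle leK rho01 C0 nT Phiab nPhi.
have /andP[rho0 rho1] := rho01.
have KB z z' : K (z - z') = K z - K z'.
  by rewrite -scaleN1r addrC lK scaleN1r addrC.
have [d d0 [dT dPhi]] : exists2 d, 0 < d &
   (forall p p' z z', ball a d p -> ball a d p' -> ball b d z -> ball b d z' ->
     enorm (Th p z - Th p' z') <= rho * enorm (K (z - z')) + C * `|p - p'|) /\
   (forall p z, ball a d p -> ball b d z -> Phi p z <-> K z = Th p z).
  have /nbhs_ballP[d1 /= d10 H1] := nT.
  have /nbhs_ballP[d2 /= d20 H2] := nPhi.
  exists (Num.min d1 d2); first by rewrite lt_min d10.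
  split=> [p p' z z' ap ap' bz bz'|p z ap bz].
    have le1 : Num.min d1 d2 <= d1 by rewrite ge_min lexx.
    apply: (H1 ((p, z), (p', z'))).
    by split; split => /=; apply: le_ball le1 _ _.
  have le2 : Num.min d1 d2 <= d2 by rewrite ge_min lexx orbT.
  by apply: (H2 (p, z)); split => /=; apply: le_ball le2 _ _.
have Kab : K b = Th a b by apply/dPhi => //; exact: ballxx.
(* A ball of radius [s] in the coordinates [K z] pulls back into the ball of radius [d] around [b],
   since [Ki] expands by at most [D]. *)
pose s := d / (2 * D).
have s0 : 0 < s by rewrite divr_gt0// mulr_gt0.
pose B := [set z | enorm (K z - K b) <= s].
have Bd z : B z -> ball b d z.
  rewrite /B/= => Bz; rewrite -ball_normE/= distrC.
  rewrite (le_lt_trans (leK _))// KB.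
  rewrite (@le_lt_trans _ _ (D * s))//.
    by rewrite (ler_wpM2l (ltW D0))// (le_trans (norm_le_enorm _)).
  have -> : D * s = d / 2 by rewrite /s; field; rewrite gt_eqF.
  by rewrite ltr_pdivrMr// ltr_pMr// ltr1n.
have nB : nbhs b B.
  apply/nbhs_ballP; exists (s / (r.+1%:R * D)) => /=.
    by rewrite divr_gt0// mulr_gt0.
  move=> z; rewrite -ball_normE/= distrC ltr_pdivlMr ?mulr_gt0// => zb.
  rewrite /B/= -KB (le_trans (enorm_le_norm _))// (le_trans _ (ltW zb))//.
  by rewrite [leRHS]mulrC -mulrA ler_wpM2l.
(* For [p] this close to [a], the center [K b] moves by at most [(1 - rho) * s], as the fixed point
   lemma requires. *)
pose e := Num.min d ((1 - rho) * s / C).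
have e0 : 0 < e by rewrite lt_min d0/= divr_gt0// mulr_gt0// subr_gt0.
have ed p : ball a e p -> ball a d p by apply: le_ball; rewrite ge_min lexx.
have ex p : ball a e p -> exists z, B z /\ K z = Th p z.
  move=> ap.
  have [||||z zB Tz] := @enorm_contraction_fixpoint r (Th p \o Ki) (K b) rho s.
  - exact: ltW.
  - by [].
  - move=> z z' zb zb' /=.
    have Bz y : enorm (y - K b) <= s -> ball b d (Ki y).
      by move=> yb; apply: Bd; rewrite /B/= KiK.
    have := dT p p _ _ (ed _ ap) (ed _ ap) (Bz _ zb) (Bz _ zb').
    by rewrite subrr normr0 mulr0 addr0 KB !KiK.
  - rewrite /= KKi Kab.
    have := dT p a b b (ed _ ap) (ballxx _ d0) (ballxx _ d0) (ballxx _ d0).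
    rewrite subrr (_ : K 0 = 0); last by rewrite -(subrr 0) KB subrr.
    rewrite enorm0 mulr0 add0r => /le_trans; apply.
    move: ap; rewrite -ball_normE/= distrC lt_min => /andP[_].
    by rewrite ltr_pdivlMr// mulrC => /ltW.
  by exists (Ki z); rewrite /B/= KiK.
(* The default [b] is never taken for [p] in the ball of radius [e], where a solution exists by
   [ex]. *)
pose h p := xget b [set z | B z /\ K z = Th p z].
have hP p : ball a e p -> B (h p) /\ K (h p) = Th p (h p).
  by move=> /ex [z zP]; rewrite /h; case: xgetP => [y ->|/(_ z)]; [|case].
have hle p p' z z' : ball a e p -> ball a e p' -> B z -> B z' ->
    K z = Th p z -> K z' = Th p' z' ->
    (1 - rho) * enorm (K (z - z')) <= C * `|p - p'|.
  move=> ap ap' Bz Bz' Kz Kz'.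
  have := dT _ _ _ _ (ed _ ap) (ed _ ap') (Bd _ Bz) (Bd _ Bz').
  by rewrite -Kz -Kz' -KB; lra.
split=> //; exists (ball a e), B, h; split.
- exact: nbhsx_ballx.
- exact: nB.
- apply/seteqP; split=> -[p z] /= => [[Ppz [ap Bz]]|[ap ->]].
    split=> //; have [Bh Kh] := hP _ ap.
    have Kz : K z = Th p z by apply/dPhi => //; [exact: ed|exact: Bd].
    have := hle _ _ _ _ ap ap Bz Bh Kz Kh.
    rewrite subrr normr0 mulr0 pmulr_rle0 ?subr_gt0// => /enorm_le0.
    by rewrite KB => /subr0_eq/(can_inj KKi).
  have [Bh Kh] := hP _ ap.
  by split; [apply/dPhi => //; [exact: ed|exact: Bd]|].
- have aa : (ball a e `*` ball a e) (a, a) by split; exact: ballxx.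
  have FF := @globally_properfilter _ _ _ aa.
  apply: (@klipschitzW _ _ _ (D * C / (1 - rho))) => -[p p'] /= [ap ap'].
  have [Bh Kh] := hP _ ap; have [Bh' Kh'] := hP _ ap'.
  have := hle _ _ _ _ ap ap' Bh Bh' Kh Kh'.
  rewrite mulrC -ler_pdivlMr ?subr_gt0// => hh.
  rewrite (le_trans (leK _))// -2!mulrA (ler_wpM2l (ltW D0))//.
  rewrite (le_trans (norm_le_enorm _))// (le_trans hh)//.
  by rewrite mulrAC.
Qed.

End Localization.

(** * Equations with a nonexpansive nonsmooth outer map *)

Section Nonsmooth.
Variable R : realType.
Implicit Types V W : normedModType R.

(** The coordinate isomorphism [c] turns [K] into a square matrix acting on row vectors; its kernel
    is zero, so it is invertible. *)
Lemma linear_inj_bij W r (c : 'cV[R]_r -> W) (d : W -> 'cV[R]_r)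
    (K : W -> 'cV[R]_r) :
  linear c -> cancel c d -> cancel d c -> linear K ->
  (forall z, K z = 0 -> z = 0) ->
  exists Ki : 'cV[R]_r -> W, [/\ linear Ki, cancel Ki K & cancel K Ki].
Proof.
move=> lc cd dc lK K0.
have c0 : c 0 = 0.
  by have := lc (-1) 0 0; rewrite scaler0 addr0 scaleN1r addNr.
pose f (v : 'rV[R]_r) := (K (c v^T))^T.
have lf : linear f by move=> a u v; rewrite /f linearP lc lK linearP.
pose L : {linear 'rV[R]_r -> 'rV[R]_r} :=
  HB.pack f (GRing.isLinear.Build R _ _ *:%R f lf).
have LE v : v *m lin1_mx L = f v by rewrite mul_rV_lin1.
have LU : lin1_mx L \in unitmx.
  rewrite -row_free_unit; apply/row_freeP.
  have /row_freeP : row_free (lin1_mx L).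
    rewrite -kermx_eq0; apply/eqP/row_matrixP => i.
    have : row i (kermx (lin1_mx L)) *m lin1_mx L = 0.
      by apply/sub_kermxP; exact: row_sub.
    rewrite LE row0 /f => /(congr1 trmx); rewrite trmxK trmx0 => /K0.
    move=> /(congr1 d); rewrite cd => /(congr1 trmx).
    rewrite trmxK => ->.
    suff -> : d 0 = 0 by rewrite trmx0.
    by rewrite -c0 cd.
  by [].
pose Ki (y : 'cV[R]_r) := c (y^T *m invmx (lin1_mx L))^T.
have lKi : linear Ki.
  by move=> a u v; rewrite /Ki linearP mulmxDl -scalemxAl linearP lc.
have KiK : cancel Ki K.
  move=> y; apply: trmx_inj.
  by rewrite -[LHS]LE mulmxKV.
exists Ki; split=> // z.
have : K (Ki (K z) - z) = 0.
  by rewrite addrC -scaleN1r lK KiK scaleN1r addNr.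
by move/K0/subr0_eq.
Qed.

(** Strict differentiability in which only the partial differential in the unknown is kept: the
    parameter part of the differential is bounded and joins the Lipschitz term. *)
Lemma strict_partial V W (f : V * W -> R) (a : V) (b : W) (e : R) :
  finite_dim V -> finite_dim W -> C1 f -> 0 < e ->
  exists C : R, 0 <= C /\ \forall q \near ((a, b), (a, b)),
   `|f q.1 - f q.2 - 'd f (a, b) (0, q.1.2 - q.2.2)| <=
     e * `|q.1.2 - q.2.2| + C * `|q.1.1 - q.2.1|.
Proof.
move=> fV fW Cf e0.
have fVW := finite_dim_prod fV fW.
have [C C0 dC] := linear_bounded_ex fVW (linearP ('d f (a, b))).
exists (e + C); split; first by rewrite addr_ge0// ltW.
apply: filterS (C1_strict (a, b) fVW Cf e0) => -[[p z] [p' z']] /= H.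
have -> : 'd f (a, b) (0, z - z') =
    'd f (a, b) ((p, z) - (p', z')) - 'd f (a, b) (p - p', 0).
  rewrite -linearB; congr ('d f (a, b) _).
  by congr (_, _); rewrite /= ?subrr ?subr0.
have := dC (p - p', 0).
have le1 : `|((p, z) - (p', z') : V * W)| <= `|p - p'| + `|z - z'|.
  by rewrite [leLHS]prod_normE/= ge_max lerDl lerDr !normr_ge0.
have -> : `|((p - p', 0) : V * W)| = `|p - p'|.
  by rewrite prod_normE/= normr0; apply/max_idPl.
move: le1; rewrite -(ler_pM2l e0) mulrDr => le1 H2.
rewrite opprB addrCA [X in `|X|]addrC (le_trans (ler_normD _ _))//.
apply: le_trans (lerD H H2) _; rewrite mulrDl.
by rewrite [leRHS]addrA lerD2r (le_trans le1)// addrC.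
Qed.

(** Since [T j] is Lipschitz with constant [t j], it suffices that the linearized arguments
    contract, each row weighted by [t j]; strict differentiability makes the nonlinear error small
    relative to [K z]. *)
Lemma nonsmooth_localization V W r (Phi : V -> set W) (a : V) (b : W)
    (c : 'cV[R]_r -> W) (d : W -> 'cV[R]_r) (K : W -> 'cV[R]_r)
    (f : 'I_r -> V * W -> R) (s t : 'I_r -> R) (T : 'I_r -> R -> R) (rho : R) :
  finite_dim V -> finite_dim W ->
  linear c -> cancel c d -> cancel d c -> linear K ->
  (forall z, K z = 0 -> z = 0) ->
  (forall j, C1 (f j)) ->
  (forall j, `|s j| <= 1) -> (forall j, 0 <= t j <= 1) ->
  (forall j x y, `|T j x - T j y| <= t j * `|x - y|) ->
  0 <= rho < 1 ->
  (forall z, enorm (\col_j (t j * (K z j 0 + s j * 'd (f j) (a, b) (0, z))))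
     <= rho * enorm (K z)) ->
  Phi a b ->
  (\forall q \near (a, b), Phi q.1 q.2 <->
     K q.2 = \col_j T j (K q.2 j 0 + s j * f j q)) ->
  lipschitz_localization Phi a b.
Proof.
move=> fV fW lc cd dc lK K0 Cf s1 t01 Tt rho01 A Phiab nPhi.
have [Ki [lKi KiK KKi]] := linear_inj_bij lc cd dc lK K0.
have [D1 D10 KD] := linear_bounded_ex fW lK.
have [D2 D20 KiD] := linear_bounded_ex (finite_dim_cV R r) lKi.
pose D := D1 + D2 + 1.
have D0 : 0 < D by rewrite ltr_wpDl// addr_ge0.
have [rho0 rho1] := andP rho01.
(* Chosen so that the nonlinear error, after passing to the Euclidean norm of [K z], is at most
   [(1 - rho) / 2] times that norm; the contraction factor becomes [(1 + rho) / 2]. *)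
pose e := (1 - rho) / 2 / (r.+1%:R * D).
have e0 : 0 < e by rewrite !divr_gt0// ?mulr_gt0// subr_gt0.
have KD' z : `|K z| <= D * `|z|.
  by rewrite (le_trans (KD z))// ler_wpM2r// /D; lra.
have KiD' z : `|z| <= D * `|K z|.
  by rewrite -{1}(KKi z) (le_trans (KiD _))// ler_wpM2r// /D; lra.
have [C HC] := choice (fun j => strict_partial a b fV fW (Cf j) e0).
pose C' := \sum_j C j.
have C'0 : 0 <= C' by apply: sumr_ge0 => j _; case: (HC j).
have CC' j : C j <= C'.
  by rewrite /C' (bigD1 j)//= lerDl sumr_ge0// => i _; case: (HC i).
pose C2 := r.+1%:R * C' + 1.
have C20 : 0 < C2 by rewrite ltr_wpDl// mulr_ge0.
apply: (@contraction_localization R V W r Phi a b K Ki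
  (fun p z => \col_j T j (K z j 0 + s j * f j (p, z))) ((1 + rho) / 2) C2 D) => //.
- by apply/andP; split; lra.
- have : \forall q \near ((a, b), (a, b)), forall j,
      `|f j q.1 - f j q.2 - 'd (f j) (a, b) (0, q.1.2 - q.2.2)| <=
      e * `|q.1.2 - q.2.2| + C j * `|q.1.1 - q.2.1|.
    exact: (@filter_forall _ _ _ (nbhs ((a, b), (a, b))) (nbhs_filter _)
      (fun j => (HC j).2)).
  apply: filterS => -[[p z] [p' z']] /= H.
  set dz := z - z' in H *; set dp := p - p' in H *.
  pose A0 := \col_j (t j * (K dz j 0 + s j * 'd (f j) (a, b) (0, dz))).
  pose err := const_mx (e * `|dz| + C' * `|dp|) : 'cV[R]_r.
  pose A1 := \col_j `|A0 j 0| : 'cV[R]_r.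
  have err0 : 0 <= e * `|dz| + C' * `|dp| by apply: addr_ge0; apply: mulr_ge0 => //; exact: ltW.
  have KB : K dz = K z - K z'.
    by rewrite /dz -scaleN1r addrC lK scaleN1r addrC.
  apply: (@le_trans _ _ (enorm (A1 + err))).
    apply: enorm_le => j; rewrite !mxE (le_trans (Tt j _ _))//.
    rewrite [leRHS](ger0_norm (addr_ge0 (normr_ge0 _) err0)).
    have [t0 t1] := andP (t01 j).
    rewrite -{1}(ger0_norm t0) -normrM.
    rewrite [X in `|X| <= _](_ : _ = t j * (K dz j 0 + s j * 'd (f j) (a, b) (0, dz)) +
      t j * s j * (f j (p, z) - f j (p', z') - 'd (f j) (a, b) (0, dz))); last first.
      rewrite KB !mxE. ring.
    rewrite (le_trans (ler_normD _ _))// lerD2l !normrM (ger0_norm t0).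
    rewrite (@le_trans _ _ (1 * (e * `|dz| + C j * `|dp|)))//.
      by rewrite ler_pM// ?mulr_ge0// mulr_ile1.
    by rewrite mul1r lerD2l ler_wpM2r.
  rewrite (le_trans (enormD _ _))//.
  have -> : enorm A1 = enorm A0.
    by congr Num.sqrt; apply: eq_bigr => j _; rewrite mxE real_normK ?num_real.
  have err_le : `|err| <= e * `|dz| + C' * `|dp|.
    by apply: mx_norm_le => // i j; rewrite mxE ger0_norm.
  have e1 : enorm err <= r.+1%:R * (e * `|dz| + C' * `|dp|).
    by rewrite (le_trans (enorm_le_norm _))// ler_wpM2l.
  have e2 : r.+1%:R * (e * `|dz|) <= (1 - rho) / 2 * enorm (K dz).
    rewrite (@le_trans _ _ (r.+1%:R * (e * (D * enorm (K dz)))))//.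
      rewrite ler_wpM2l// ler_wpM2l ?(ltW e0)// (le_trans (KiD' _))//.
      by rewrite ler_wpM2l ?(ltW D0)// norm_le_enorm.
    rewrite le_eqVlt; apply/orP; left; apply/eqP; rewrite /e; field.
    by rewrite gt_eqF//= gt_eqF.
  have e3 : r.+1%:R * (C' * `|dp|) <= C2 * `|dp|.
    by rewrite mulrA ler_wpM2r// /C2 lerDl.
  have := A dz; rewrite -/A0.
  move: e1; rewrite mulrDr; lra.
- by apply: filterS nPhi => -[p z].
Qed.

End Nonsmooth.

(** * Localization for KKT systems *)

Section KKTLinear.
Variables (R : realType) (a b : nat) (H : 'M[R]_a) (J : 'M[R]_(b, a)).
Variables (A1 A2 : pred 'I_b).
Hypothesis A12 : forall i, A2 i -> ~~ A1 i.
Hypothesis licq : forall mu : 'cV[R]_b,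
  (forall i, ~~ A1 i -> ~~ A2 i -> mu i 0 = 0) -> J^T *m mu = 0 -> mu = 0.
Hypothesis posdef : forall y : 'cV[R]_a, y != 0 ->
  (forall i, A1 i -> (J *m y) i 0 = 0) -> 0 < qform H y.

(** The minus sign on the strongly active rows makes [K z + G] lose its linear part there, as
    [K z - F] does in the stationarity rows. The remaining rows carry the multiplier itself, ready
    for the projection. *)
Definition kktK (z : 'cV[R]_a * 'cV[R]_b) : 'cV[R]_(a + b) :=
  col_mx (H *m z.1 + J^T *m z.2)
         (\col_i if A1 i then - (J *m z.1) i 0 else z.2 i 0).

Lemma kktK_linear : linear kktK.
Proof.
move=> c [x l] [x' l']; rewrite /kktK /= scale_col_mx add_col_mx; congr col_mx.
  by rewrite !mulmxDr -!scalemxAr scalerDr addrACA.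
rewrite mulmxDr -scalemxAr; move: (J *m x) (J *m x') => u u'.
by apply/colP => i; rewrite !mxE; case: ifP => // _; ring.
Qed.

(** [- t * q] is the cross term in the square of [l + t J x] over the weakly active rows; [s] below
    is the part of the squared norm of [kktK z] carried by all other rows. *)
Let q (z : 'cV[R]_a * 'cV[R]_b) : R :=
  - 2 * \sum_(i | A2 i) z.2 i 0 * (J *m z.1) i 0.
Let s (z : 'cV[R]_a * 'cV[R]_b) : R :=
  \sum_i (H *m z.1 + J^T *m z.2) i 0 ^+ 2 +
  (\sum_(i | A1 i) (J *m z.1) i 0 ^+ 2 +
   \sum_(i | ~~ A1 i && ~~ A2 i) z.2 i 0 ^+ 2).

Lemma sqr_enorm_kktK z :
  enorm (kktK z) ^+ 2 = s z + \sum_(i | A2 i) z.2 i 0 ^+ 2.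
Proof.
rewrite sqr_enorm big_split_ord/= /s -!addrA; congr (_ + _).
  by apply: eq_bigr => i _; rewrite col_mxEu.
rewrite (bigID A1)/=; congr (_ + _).
  by apply: eq_bigr => i Ai; rewrite col_mxEd mxE Ai sqrrN.
rewrite (bigID A2)/= addrC; congr (_ + _).
  by apply: eq_bigr => i /andP[/negbTE Ai _]; rewrite col_mxEd mxE Ai.
apply: eq_big => [i|i /andP[/negbTE Ai _]]; last by rewrite col_mxEd mxE Ai.
by case: (boolP (A2 i)) => [/A12 ->|_]; rewrite ?andbF.
Qed.

Lemma s_ge0 z : 0 <= s z.
Proof. by rewrite !addr_ge0// sumr_ge0// => i _; exact: sqr_ge0. Qed.

(** If [s z = 0], pairing [H x + J^T l = 0] with [x] leaves only the weakly active products, so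
    [q z = 2 x^T H x]. Here [x] is nonzero, since otherwise [J^T l = 0] and [licq] would give
    [l = 0]. *)
Lemma kkt_pos z : z != 0 -> s z = 0 -> 0 < q z.
Proof.
case: z => x l z0 /eqP.
have ge0 n (P : pred 'I_n) (f : 'I_n -> R) : 0 <= \sum_(i | P i) f i ^+ 2.
  by apply: sumr_ge0 => i _; exact: sqr_ge0.
rewrite !paddr_eq0 ?addr_ge0 ?ge0//= => /and3P[].
rewrite !psumr_eq0 => [|i _|i _|i _]; [|exact: sqr_ge0..].
move=> /allP h1 /allP h2 /allP h3.
have e1 : H *m x + J^T *m l = 0.
  by apply/colP => i; have := h1 i (mem_index_enum i); rewrite /= sqrf_eq0 => /eqP ->; rewrite mxE.
have e2 i : A1 i -> (J *m x) i 0 = 0.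
  by move=> Ai; have := h2 i (mem_index_enum i); rewrite Ai /= sqrf_eq0 => /eqP.
have e3 i : ~~ A1 i -> ~~ A2 i -> l i 0 = 0.
  by move=> Ai Bi; have := h3 i (mem_index_enum i); rewrite Ai Bi /= sqrf_eq0 => /eqP.
have x0 : x != 0.
  apply/eqP => x0; move: e1; rewrite x0 mulmx0 add0r => /(licq e3) l0.
  by move/eqP: z0; apply; rewrite x0 l0.
have := posdef x0 e2.
have : x^T *m (H *m x + J^T *m l) = 0 by rewrite e1 mulmx0.
rewrite mulmxDr !mulmxA -trmx_mul => /(congr1 (fun M : 'M[R]_1 => M 0 0)).
rewrite [LHS]mxE [X in _ + X]mxE [RHS]mxE /qform /q /=.
rewrite (bigID A2)/= [X in _ + (_ + X)]big1 => [|i Ai]; last first.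
  case: (boolP (A1 i)) => Ai1; first by rewrite mxE e2// mul0r.
  by rewrite e3// mulr0.
under eq_bigr do rewrite mxE mulrC.
rewrite addr0; lra.
Qed.

Lemma kktK_inj z : kktK z = 0 -> z = 0.
Proof.
move=> Kz; apply: contrapT => /eqP z0.
have := sqr_enorm_kktK z; rewrite Kz enorm0 expr0n/= => /esym/eqP.
rewrite paddr_eq0 ?s_ge0//; last by rewrite sumr_ge0// => i _; exact: sqr_ge0.
move=> /andP[/eqP/(kkt_pos z0)].
rewrite psumr_eq0 => [+ /allP h|i _]; last exact: sqr_ge0.
rewrite /q big1 ?mulr0 ?ltxx// => i Ai.
by have := h i (mem_index_enum i); rewrite Ai/= sqrf_eq0 => /eqP ->; rewrite mul0r.
Qed.

(** The left side is [\sum l_i^2 - t q + t^2 \sum (J x)_i^2] over the weakly active rows. Finsler's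
    bound [c |z|^2 <= q + k s] with [t k <= 1] gives [- t q <= s - t c |z|^2], and half of that gain
    pays for the [t^2] term. What remains is at most the squared norm of [kktK z] minus
    [t (c / 2) |z|^2]. *)
Lemma kkt_contraction : exists t rho : R, [/\ 0 < t <= 1, 0 <= rho < 1 &
  forall z : 'cV[R]_a * 'cV[R]_b,
  \sum_(i | A2 i) (z.2 i 0 + t * (J *m z.1) i 0) ^+ 2 <=
     rho ^+ 2 * enorm (kktK z) ^+ 2].
Proof.
pose Z (y : 'cV[R]_(a + b)) := (usubmx y, dsubmx y).
have lx : linear (fun y : 'cV[R]_(a + b) => usubmx y) by exact: linearP.
have ly : linear (fun y : 'cV[R]_(a + b) => dsubmx y) by exact: linearP.
have lentry n m (M : 'M[R]_(n, m)) i (f : 'cV[R]_(a + b) -> 'cV[R]_m) :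
  linear f -> linear (fun y => (M *m f y) i 0).
  by move=> lf c u v; rewrite lf mulmxDr -scalemxAr !mxE.
have fd := finite_dim_cV R (a + b).
have Clin f : linear f -> C1 (f : 'cV[R]_(a + b) -> R) by exact: C1_lin.
have Cl i : C1 (fun y : 'cV[R]_(a + b) => (dsubmx y) i 0).
  by apply: Clin => c u v; rewrite !mxE.
have CJ i : C1 (fun y : 'cV[R]_(a + b) => (J *m usubmx y) i 0).
  exact/Clin/lentry.
have CH i : C1 (fun y : 'cV[R]_(a + b) => (H *m usubmx y + J^T *m dsubmx y) i 0).
  apply: Clin => c u v; rewrite lx ly !mulmxDr -!scalemxAr.
  move: (H *m usubmx u) (H *m usubmx v) (J^T *m dsubmx u) (J^T *m dsubmx v) => w1 w2 w3 w4.
  rewrite !mxE -[RHS]/(_ * _ + _); ring.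
have C1sq (f : 'cV[R]_(a + b) -> R) : C1 f -> C1 (fun y => f y ^+ 2).
  by move=> Cf; exact: C1M.
have uZ c (y : 'cV[R]_(a + b)) : usubmx (c *: y) = c *: usubmx y by exact: linearZ.
have dZ c (y : 'cV[R]_(a + b)) : dsubmx (c *: y) = c *: dsubmx y by exact: linearZ.
have [||||||k [c [k0 c0 kc]]] := @finsler R (a + b) (q \o Z) (s \o Z).
- apply: C1_continuous; apply: C1M; first exact: C1_cst.
  by apply: C1_sum => i _; apply: C1M; [exact: Cl|exact: CJ].
- apply: C1_continuous; apply: C1D; last apply: C1D; apply: C1_sum => i _; exact: C1sq.
- move=> c y; rewrite /q /= mulrCA; congr (_ * _).
  rewrite mulr_sumr; apply: eq_bigr => i _.
  rewrite uZ dZ -scalemxAr; move: (J *m _) (dsubmx y) => v w.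
  by rewrite !mxE; ring.
- move=> c y; rewrite /s /= uZ dZ -!scalemxAr -scalerDr.
  rewrite !mulrDr !mulr_sumr; congr (_ + (_ + _)); apply: eq_bigr => i _;
    by rewrite -exprMn; congr (_ ^+ 2); rewrite [LHS]mxE.
- by move=> y; exact: s_ge0.
- move=> y y0; apply: kkt_pos; apply: contra y0 => /eqP[/= u0 d0].
  by rewrite -[y]vsubmxK u0 d0 col_mx0.
have [D1 D10 JD] := @linear_bounded_ex R _ _ (fun y : 'cV[R]_(a + b) => J *m usubmx y) fd
  (fun c u v => etrans (congr1 _ (lx c u v)) (linearP (mulmx J) c _ _)).
have lKZ : linear (kktK \o Z).
  by move=> c' u v; rewrite /= -kktK_linear /Z lx ly.
have [D2 D20 KD] := linear_bounded_ex fd lKZ.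
pose S := (b.+1%:R * D1) ^+ 2; pose N := ((a + b).+1%:R * D2) ^+ 2 + 1.
have S0 : 0 <= S by exact: sqr_ge0.
have N0 : 0 < N by rewrite ltr_wpDl// sqr_ge0.
have SJ (y : 'cV[R]_(a + b)) : \sum_(i | A2 i) (J *m usubmx y) i 0 ^+ 2 <= S * `|y| ^+ 2.
  apply: (@le_trans _ _ (enorm (J *m usubmx y) ^+ 2)).
    rewrite sqr_enorm [leRHS](bigID A2)/= lerDl sumr_ge0// => i _; exact: sqr_ge0.
  rewrite /S -exprMn ler_sqr ?nnegrE ?enorm_ge0 ?mulr_ge0//.
  by rewrite (le_trans (enorm_le_norm _))// -mulrA ler_wpM2l.
have NK (y : 'cV[R]_(a + b)) : enorm (kktK (Z y)) ^+ 2 <= N * `|y| ^+ 2.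
  apply: (@le_trans _ _ (((a + b).+1%:R * D2) ^+ 2 * `|y| ^+ 2)).
    rewrite -exprMn ler_sqr ?nnegrE ?enorm_ge0 ?mulr_ge0//.
    by rewrite (le_trans (enorm_le_norm _))// -mulrA ler_wpM2l//; exact: KD.
  by rewrite ler_wpM2r ?sqr_ge0// lerDl.
(* Its inverse [t] satisfies [t <= 1], [t * k <= 1] and [t * S <= c / 2] at once. *)
pose w := 1 + k + 2 * S / c.
have w1 : 1 <= w by rewrite /w -addrA lerDl addr_ge0// divr_ge0 ?mulr_ge0 ?(ltW c0).
have w0 : 0 < w by exact: lt_le_trans w1.
pose t := w^-1; have t0 : 0 < t by rewrite invr_gt0.
have t1 : t <= 1 by rewrite invf_le1.
have tk : t * k <= 1.
  rewrite mulrC ler_pdivrMr// mul1r /w.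
  have : 0 <= 2 * S / c by rewrite divr_ge0 ?mulr_ge0 ?(ltW c0).
  lra.
have tS : t * S <= c / 2.
  rewrite mulrC ler_pdivrMr//.
  have -> : c / 2 * w = c / 2 * (1 + k) + S by rewrite /w; field; rewrite gt_eqF.
  by rewrite lerDr mulr_ge0 ?addr_ge0// divr_ge0// ltW.
(* The second summand of the denominator ensures [e <= 1], while still [e * N <= t * (c / 2)]; hence
   the gain in [|z|^2] is worth a fraction [e] of the squared norm of [kktK z]. *)
pose e := t * (c / 2) / (N + t * (c / 2)).
have tc0 : 0 < t * (c / 2) by rewrite mulr_gt0// divr_gt0.
have e0 : 0 < e by rewrite divr_gt0// addr_gt0.
have d0 : 0 < N + t * (c / 2) by rewrite addr_gt0.
have e1 : e <= 1 by rewrite /e ler_pdivrMr// mul1r lerDr ltW.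
have eN : e * N <= t * (c / 2).
  by rewrite /e mulrAC ler_pdivrMr// ler_pM2l// lerDl ltW.
exists t; exists (Num.sqrt (1 - e)); split; first by rewrite t0.
  rewrite sqrtr_ge0 -[ltRHS]sqrtr1 ltr_sqrt//; lra.
move=> z; pose y := col_mx z.1 z.2.
have -> : z = Z y by rewrite /Z /y col_mxKu col_mxKd; case: z {y}.
rewrite sqr_sqrtr ?subr_ge0//.
have := kc y; have := SJ y; have := NK y; rewrite sqr_enorm_kktK /=.
rewrite (_ : \sum_(i | A2 i) ((Z y).2 i 0 + t * (J *m (Z y).1) i 0) ^+ 2 =
   \sum_(i | A2 i) (Z y).2 i 0 ^+ 2 - t * q (Z y) +
   t ^+ 2 * \sum_(i | A2 i) (J *m (Z y).1) i 0 ^+ 2); last first.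
  rewrite /q mulrA !mulr_sumr -sumrB -big_split/=; apply: eq_bigr => i _.
  by move: (J *m _) => v; ring.
have := s_ge0 (Z y).
rewrite /=; move: (s (Z y)) (q (Z y)) (\sum_(i | A2 i) (dsubmx y) i 0 ^+ 2)
  (\sum_(i | A2 i) (J *m _) i 0 ^+ 2) (`|y| ^+ 2) (sqr_ge0 `|y|) => ss qq l2 sg n n0 ss0 HN HS Hk.
have h1 : e * (ss + l2) <= t * (c / 2) * n.
  apply: le_trans (ler_wpM2r n0 eN).
  by rewrite -[leRHS]mulrA (ler_pM2l e0).
have h2 : t ^+ 2 * sg <= t * (c / 2) * n.
  rewrite expr2 -!mulrA (ler_wpM2l (ltW t0))//.
  by rewrite (le_trans (ler_wpM2l (ltW t0) HS))// 2!mulrA ler_wpM2r.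
have h3 : t * (c * n) <= t * qq + ss.
  apply: (@le_trans _ _ (t * (qq + k * ss))); first by rewrite ler_wpM2l// ltW.
  by rewrite mulrDr lerD2l mulrA ler_piMl.
rewrite mulrBl mul1r.
have : t * (c / 2) * n = t * (c * n) / 2 by field.
lra.
Qed.
End KKTLinear.

(** Any positive scale [t] encodes the same complementarity condition, so [t] may be dictated by
    [kkt_contraction]. *)
Lemma complementarity_max (R : realType) (l g t : R) : 0 < t ->
  ([/\ 0 <= l, g <= 0 & l * g = 0] <-> l = Num.max 0 (l + t * g)).
Proof.
move=> t0; split=> [[l0 g0 /eqP]|].
  rewrite mulf_eq0 => /orP[/eqP ->|/eqP ->].
    by rewrite add0r max_l// mulr_ge0_le0// ltW.
  by rewrite mulr0 addr0 max_r.
move=> e; have l0 : 0 <= l by rewrite e le_max lexx.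
have g0 : g <= 0.
  rewrite -(pmulr_rle0 _ t0) -(lerD2l l) addr0 [leRHS]e le_max lexx orbT//.
split=> //; move: e; case: leP => _ e; last by rewrite e mul0r.
have : t * g = 0 by apply: (addrI l); rewrite addr0 -e.
by move/eqP; rewrite mulf_eq0 gt_eqF//= => /eqP ->; rewrite mulr0.
Qed.

(** * From KKT systems to fixed-point equations *)

Section KKTLocalization.
Variables (R : realType) (V : normedModType R) (a b : nat).
Local Notation Z := ('cV[R]_a * 'cV[R]_b)%type.
Variables (F : 'I_a -> V * Z -> R) (G : 'I_b -> V * Z -> R) (eqc : pred 'I_b).

Definition kkt_system (p : V) : set Z :=
  [set z | (forall i, F i (p, z) = 0) /\ forall i,
    (eqc i -> G i (p, z) = 0) /\
    (~~ eqc i ->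
      [/\ 0 <= z.2 i 0, G i (p, z) <= 0 & z.2 i 0 * G i (p, z) = 0])].

Variables (p0 : V) (z0 : Z) (H : 'M[R]_a) (J : 'M[R]_(b, a)).

(** The value of the constraint is not tested: at a KKT point, complementarity makes it vanish when
    the multiplier is positive. *)
Definition strongly_active : pred 'I_b :=
  fun i => eqc i || (0 < z0.2 i 0).
Definition weakly_active : pred 'I_b :=
  fun i => ~~ strongly_active i && (G i (p0, z0) == 0).

Hypothesis fV : finite_dim V.
Hypothesis CF : forall i, C1 (F i).
Hypothesis CG : forall i, C1 (G i).
Hypothesis dF : forall i z,
  'd (F i) (p0, z0) (0, z) = (H *m z.1 + J^T *m z.2) i 0.
Hypothesis dG : forall i z, 'd (G i) (p0, z0) (0, z) = (J *m z.1) i 0.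
Hypothesis kkt0 : kkt_system p0 z0.
Hypothesis licq : forall mu : 'cV[R]_b,
  (forall i, ~~ strongly_active i -> ~~ weakly_active i -> mu i 0 = 0) ->
  J^T *m mu = 0 -> mu = 0.
Hypothesis posdef : forall y : 'cV[R]_a, y != 0 ->
  (forall i, strongly_active i -> (J *m y) i 0 = 0) -> 0 < qform H y.

Lemma C1_dual i : C1 (fun q : V * Z => q.2.2 i 0).
Proof.
apply: C1_lin; first by do 2!apply: finite_dim_prod => //; exact: finite_dim_cV.
by move=> c [u [x l]] [u' [x' l']]; rewrite /= !mxE.
Qed.

Let K := kktK H J strongly_active.

Theorem kkt_localization : lipschitz_localization kkt_system p0 z0.
Proof.
have A12 i : weakly_active i -> ~~ strongly_active i by case/andP.
have [t [rho [/andP[t0 t1] rho01 est]]] := kkt_contraction A12 licq posdef.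
(* Row by row, [K z = T (K z + s f)] reads [F = 0], then [G = 0] if strongly active,
   [l = max 0 (l + t G)] if weakly active, and [l = 0] if inactive; [c] is the Lipschitz constant of
   the row of [T]. *)
pose f (j : 'I_(a + b)) : V * Z -> R :=
  match fintype.split j with inl i => F i | inr i => G i end.
pose s (j : 'I_(a + b)) : R := match fintype.split j with inl _ => -1
  | inr i => if strongly_active i then 1 else if weakly_active i then t else 0 end.
pose T (j : 'I_(a + b)) (x : R) : R := match fintype.split j with inl _ => x
  | inr i => if strongly_active i then x
             else if weakly_active i then Num.max 0 x else 0 end.
pose c (j : 'I_(a + b)) : R := match fintype.split j with inl _ => 1
  | inr i => if strongly_active i || weakly_active i then 1 else 0 end.
pose vec (z : Z) : 'cV[R]_(a + b) := col_mx z.1 z.2.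
pose unvec (y : 'cV[R]_(a + b)) : Z := (usubmx y, dsubmx y).
have splitL i : fintype.split (lshift b i) = inl i.
  exact: (unsplitK (inl i)).
have splitR i : fintype.split (rshift a i) = inr i.
  exact: (unsplitK (inr i)).
have fZ : finite_dim Z by apply: finite_dim_prod; exact: finite_dim_cV.
apply: (@nonsmooth_localization R V Z (a + b) kkt_system p0 z0 unvec vec K f s c T rho) => //.
- by move=> d u v; rewrite /unvec !linearP.
- by move=> y; rewrite /vec/= vsubmxK.
- by move=> [x l]; rewrite /unvec/= col_mxKu col_mxKd.
- exact: kktK_linear.
- exact: (kktK_inj A12 licq posdef).
- by move=> j; rewrite /f; case: (fintype.split j).
- move=> j; rewrite /s; case: (fintype.split j) => [_|i]; first by rewrite normrN normr1.
  by case: ifP; [rewrite normr1|case: ifP; rewrite ?normr0// gtr0_norm].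
- move=> j; rewrite /c; case: (fintype.split j) => [_|i]; first by rewrite ler01 lexx.
  by case: ifP; rewrite ?ler01 lexx.
- move=> j x y; rewrite /c /T; case: (fintype.split j) => [_|i]; first by rewrite mul1r.
  case: ifP => /=; first by rewrite mul1r.
  case: ifP; rewrite ?mul1r ?subrr ?normr0 ?mul0r// => _ _.
  have := ler_norm (x - y); have := ler_norm (y - x); rewrite (distrC y).
  have := normr_ge0 (x - y); move: `|x - y| => N.
  by rewrite ler_norml; case: (leP 0 x); case: (leP 0 y) => ? ? ? ? ?; apply/andP; split; lra.
(* Stationarity and strongly active rows cancel, inactive rows have [c = 0], and the weakly active
   rows are those of [est]. *)
- move=> z; rewrite -ler_sqr ?nnegrE ?enorm_ge0 ?mulr_ge0 ?enorm_ge0//; last by case/andP: rho01.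
  rewrite exprMn (le_trans _ (est z))// sqr_enorm big_split_ord/= big1 ?add0r => [|i _].
    rewrite [leRHS]big_mkcond ler_sum// => i _.
    rewrite mxE /c /f /s splitR col_mxEd mxE dG.
    case: (boolP (strongly_active i)) => /= Si.
      by rewrite mul1r mul1r addNr expr0n; case: ifP => // _; exact: sqr_ge0.
    by case: ifP => _; rewrite ?mul1r// mul0r expr0n.
  by rewrite mxE /c /f /s splitL col_mxEu dF mulN1r subrr mulr0 expr0n.
(* Positive multipliers and, in [N2], strictly satisfied constraints persist nearby, so
   complementarity there forces [G = 0] or [l = 0] respectively. *)
have N1 : \forall q \near (p0, z0), forall i, 0 < z0.2 i 0 -> 0 < (q.2.2 : 'cV[R]_b) i 0.
  apply: (@filter_forall _ _ (fun i (q : V * Z) => 0 < z0.2 i 0 -> 0 < q.2.2 i 0)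
    (nbhs (p0, z0)) (nbhs_filter _)) => i.
  have [l0|l0] := ltP 0 (z0.2 i 0); last by apply: nearW => q.
  have := near_lt_cont (w := (p0, z0)) (C1_cst _ 0) (C1_dual i) l0; apply: filterS => q h _.
  exact: h.
have N2 : \forall q \near (p0, z0), forall i, G i (p0, z0) < 0 -> G i q < 0.
  apply: (@filter_forall _ _ (fun i (q : V * Z) => G i (p0, z0) < 0 -> G i q < 0)
    (nbhs (p0, z0)) (nbhs_filter _)) => i.
  have [g0|g0] := ltP (G i (p0, z0)) 0; last by apply: nearW => q.
  have := near_lt_cont (w := (p0, z0)) (CG i) (C1_cst _ 0) g0; apply: filterS => q h _.
  exact: h.
apply: filterS2 N1 N2 => -[p z] h1 h2 /=.
have I0 i : ~~ strongly_active i -> ~~ weakly_active i -> G i (p0, z0) < 0.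
  move=> Si; rewrite /weakly_active Si /= => g0.
  have [_ /(_ i)[_]] := kkt0; case/norP: Si => ei li /(_ ei)[_ g00 _].
  by rewrite lt_neqAle g0.
have E i : (K z (rshift a i) 0 =
    T (rshift a i) (K z (rshift a i) 0 + s (rshift a i) * f (rshift a i) (p, z)))
   <-> ((eqc i -> G i (p, z) = 0) /\
    (~~ eqc i ->
      [/\ 0 <= z.2 i 0, G i (p, z) <= 0 & z.2 i 0 * G i (p, z) = 0])).
  rewrite /T /s /f splitR col_mxEd mxE.
  case: (boolP (strongly_active i)) => Si.
    rewrite mul1r; split=> [e|[e1 e2]].
      have g0 : G i (p, z) = 0 by move/eqP: e; rewrite addrC -subr_eq subrr eq_sym => /eqP.
      split=> // ei; rewrite g0 mulr0; split=> //.
      by apply/ltW/h1; move: Si; rewrite /strongly_active (negbTE ei).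
    suff -> : G i (p, z) = 0 by rewrite addr0.
    case: (boolP (eqc i)) => ei; first exact: e1.
    have [_ _ /eqP] := e2 ei; rewrite mulf_eq0 gt_eqF ?h1//=; first by move/eqP.
    by move: Si; rewrite /strongly_active (negbTE ei).
  have /norP[ei _] := Si.
  case: (boolP (weakly_active i)) => Wi.
    by rewrite -complementarity_max//; split=> [e|[_ /(_ ei)]//]; split=> // /(negP ei).
  have g0 := h2 _ (I0 _ Si Wi); split=> [->|[_ /(_ ei)[_ _ /eqP]]].
    split=> [/(negP ei)//|_]; rewrite mul0r; split=> //; exact: ltW.
  by rewrite mulf_eq0 (lt_eqF g0) orbF => /eqP.
have E' i : (K z (lshift b i) 0 =
    T (lshift b i) (K z (lshift b i) 0 + s (lshift b i) * f (lshift b i) (p, z)))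
   <-> F i (p, z) = 0.
  rewrite /T /s /f splitL mulN1r; split=> [/eqP|->]; last by rewrite subr0.
  by rewrite -[X in X == _]addr0 (inj_eq (addrI _)) eq_sym oppr_eq0 => /eqP.
split=> [[k1 k2]|/colP k].
  apply/colP => j; rewrite mxE; case: (split_ordP j) => i ->; first exact/E'.
  exact/E.
split=> i.
  by apply/E'; have := k (lshift b i); rewrite mxE.
by apply/E; have := k (rshift a i); rewrite mxE.
Qed.

End KKTLocalization.

(** * Functions of class C^2 and block vectors *)

Section C2Closure.
Variable R : realType.
Implicit Types V W : normedModType R.

Lemma C2_C1_derive V (f : V -> R) v : C2 f -> C1 ('D_v f : V -> R).
Proof. by move=> [_ /(_ v)]. Qed.

Lemma C2_C1 V (f : V -> R) : C2 f -> C1 f.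
Proof.
move=> [df ddf]; split=> // v x.
by apply: differentiable_continuous; exact: (ddf v).1.
Qed.

Lemma C2_intro V (f : V -> R) :
  C1 f -> (forall v, C1 ('D_v f : V -> R)) -> C2 f.
Proof. by case. Qed.

Lemma C2D V (f g : V -> R) : C2 f -> C2 g -> C2 (fun x => f x + g x).
Proof.
move=> Cf Cg; have [df _] := Cf; have [dg _] := Cg.
apply: C2_intro => [|v]; first exact: (C1D (C2_C1 Cf) (C2_C1 Cg)).
rewrite (_ : 'D_v _ = fun x => 'D_v f x + 'D_v g x); last first.
  by apply/funext => x; rewrite deriveD//; exact: diff_derivable.
exact: (C1D (C2_C1_derive v Cf) (C2_C1_derive v Cg)).
Qed.

Lemma C2M V (f g : V -> R) : C2 f -> C2 g -> C2 (fun x => f x * g x).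
Proof.
move=> Cf Cg; have [df _] := Cf; have [dg _] := Cg.
apply: C2_intro => [|v]; first exact: (C1M (C2_C1 Cf) (C2_C1 Cg)).
rewrite (_ : 'D_v _ = fun x => f x * 'D_v g x + g x * 'D_v f x); last first.
  by apply/funext => x; rewrite deriveM//; exact: diff_derivable.
exact: (C1D (C1M (C2_C1 Cf) (C2_C1_derive v Cg)) (C1M (C2_C1 Cg) (C2_C1_derive v Cf))).
Qed.

Lemma C2_cst V (c : R) : C2 (fun _ : V => c).
Proof.
apply: C2_intro => [|v]; first exact: C1_cst.
rewrite (_ : 'D_v _ = fun=> 0); first exact: C1_cst.
by apply/funext => y; rewrite derive_cst.
Qed.

Lemma C2_sum V (I : Type) (s : seq I) (P : pred I) (f : I -> V -> R) :
  (forall i, P i -> C2 (f i)) -> C2 (fun x => \sum_(i <- s | P i) f i x).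
Proof.
move=> Cf; elim: s => [|i s IH].
  rewrite (_ : (fun x => _) = fun=> 0); first exact: C2_cst.
  by apply/funext => x; rewrite big_nil.
rewrite (_ : (fun x => _) = fun x => (if P i then f i x else 0) +
    \sum_(j <- s | P j) f j x).
  by apply: C2D IH; case Pi: (P i); [exact: Cf|exact: C2_cst].
by apply/funext => x; rewrite big_cons; case: ifP; rewrite ?add0r.
Qed.

(* Directional derivatives commute with maps that are affine along the
   direction: the two difference quotients are the same function. *)
Lemma derive_affine V W (l : V -> W) (f : W -> R) (x v : V) (v' : W) :
  (forall h : R, l (h *: v + x) = h *: v' + l x) ->
  'D_v (fun y => f (l y)) x = 'D_v' f (l x).
Proof.
move=> lE; rewrite /derive; set d := (fun _ : R => _).
set d' := (fun _ : R => _); suff -> : d = d' by [].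
by apply/funext => h; rewrite /d /d' /= lE.
Qed.

Lemma C2_comp_lin V W (l : V -> W) (f : W -> R) :
  finite_dim V -> linear l -> C2 f -> C2 (fun x => f (l x)).
Proof.
move=> fV ll Cf; apply: C2_intro => [|v].
  exact: (C1_comp_lin fV ll (C2_C1 Cf)).
rewrite (_ : 'D_v _ = fun y => 'D_(l v) f (l y)); last first.
  by apply/funext => y; apply: derive_affine => h; rewrite ll.
exact: (C1_comp_lin fV ll (C2_C1_derive (l v) Cf)).
Qed.

Lemma derive_lin V (l : V -> R) x v : finite_dim V -> linear l ->
  'D_v l x = l v.
Proof.
move=> fV ll; have cl := linear_cont fV ll.
pose L : {linear V -> R} := HB.pack l (GRing.isLinear.Build R V R *:%R l ll).
have dL : differentiable (L : V -> R) x by exact: linear_differentiable.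
by rewrite -[l]/(L : V -> R) deriveE// diff_lin.
Qed.

Lemma C2_lin V (l : V -> R) : finite_dim V -> linear l -> C2 l.
Proof.
move=> fV ll; apply: C2_intro => [|v]; first exact: C1_lin.
rewrite (_ : 'D_v _ = fun=> l v); first exact: C1_cst.
by apply/funext => x; exact: (derive_lin x v fV ll).
Qed.

End C2Closure.

Section Blocks.
Variables (N : nat) (n : 'I_N -> nat).

(** Stated for a whole family [h], because the type of the second component depends on the first and
    they cannot be rewritten separately. *)
Lemma rank_sig T (h : forall k, 'I_(n k) -> T) k i :
  h (tagnat.sig1 (tagnat.Rank k i)) (tagnat.sig2 (tagnat.Rank k i)) = h k i.
Proof. by rewrite /tagnat.sig1 /tagnat.sig2 /tagnat.Rank tagnat.rankK. Qed.

Lemma sum_rank (R : realType) (f : 'I_(\sum_k n k)%N -> R) :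
  \sum_a f a = \sum_k \sum_a f (@tagnat.Rank _ n k a).
Proof.
rewrite sig_big_dep/= (reindex _ tagnat.sig_bij_on)/=.
by apply: eq_bigr => a _; rewrite -tagnat.rankE tagnat.sigK.
Qed.

End Blocks.

(** * The KKT system of the game *)

Section Flat.
Context {R : realType} {N : nat} {n m d : 'I_N -> nat} (G : nep R n m d).
Local Notation param := (blockvec R m * blockvec R n * blockvec R d)%type.
Local Notation point := (param * (blockvec R n * blockvec R m))%type.

Lemma finite_dim_param : finite_dim param.
Proof.
apply: finite_dim_prod; last exact: finite_dim_cV.
by apply: finite_dim_prod; exact: finite_dim_cV.
Qed.

Lemma finite_dim_point : finite_dim point.
Proof.
apply: finite_dim_prod; first exact: finite_dim_param.
by apply: finite_dim_prod; exact: finite_dim_cV.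
Qed.

(** This and [lag] are functions of parameters, strategies and multipliers jointly, so that their
    regularity in all variables follows by composition with linear maps. *)
Definition con k (i : 'I_(m k)) (q : point) : R :=
  constr G i (submxcol q.2.1 k, pw q.1 k).

Definition lag k (q : point) : R :=
  lagrangian G (submxcol q.2.2 k) (pw q.1 k) q.2.1.

Definition xdir (v : blockvec R n) : point := (0, (v, 0)).

Definition fgrad (a : 'I_(\sum_k n k)%N) (q : point) : R :=
  'D_(xdir (delta_mx a 0)) (lag (tagnat.sig1 a)) q - q.1.1.2 a 0.

Definition fcon (i : 'I_(\sum_k m k)%N) (q : point) : R :=
  con (tagnat.sig2 i) q - q.1.1.1 i 0.

Definition feq (i : 'I_(\sum_k m k)%N) : bool :=
  (tagnat.sig2 i < num_eq G (tagnat.sig1 i))%N.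

Lemma submxcol_linear r (q : 'I_N -> nat) k :
  linear (fun v : 'M[R]_(\sum_k q k, r) => submxcol v k).
Proof. by move=> c u v; apply/matrixP => i j; rewrite !mxE. Qed.

Lemma con_C2 k (i : 'I_(m k)) : C2 (con i).
Proof.
apply: (@C2_comp_lin _ _ _ (fun q : point => (submxcol q.2.1 k, submxcol q.1.2 k))).
- exact: finite_dim_point.
- by move=> c u v /=; rewrite !submxcol_linear.
- exact: constr_C2.
Qed.

Lemma lag_C2 k : C2 (lag k).
Proof.
apply: C2D.
  apply: (@C2_comp_lin _ _ _ (fun q : point => (q.2.1, submxcol q.1.2 k))).
  - exact: finite_dim_point.
  - by move=> c u v /=; rewrite submxcol_linear.
  - exact: cost_C2.
apply: C2_sum => i _; apply: C2M; last exact: con_C2.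
by apply: C2_lin; [exact: finite_dim_point|move=> c u v; rewrite /= !mxE].
Qed.

Lemma fgrad_C1 a : C1 (fgrad a).
Proof.
apply: C1D; first exact: C2_C1_derive (lag_C2 _).
apply: C1N; apply: C1_lin; first exact: finite_dim_point.
by move=> c u v; rewrite /= !mxE.
Qed.

Lemma fcon_C1 i : C1 (fcon i).
Proof.
apply: C1D; first exact: C2_C1 (con_C2 _).
apply: C1N; apply: C1_lin; first exact: finite_dim_point.
by move=> c u v; rewrite /= !mxE.
Qed.

Lemma fcon_Rank k (i : 'I_(m k)) q :
  fcon (tagnat.Rank k i) q = con i q - pu q.1 k i 0.
Proof.
rewrite /fcon; congr (_ - _); last by rewrite /pu mxE.
exact: (@rank_sig _ _ _ (fun k (i : 'I_(m k)) => con i q)).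
Qed.

Lemma feq_Rank k (i : 'I_(m k)) : feq (tagnat.Rank k i) = (i < num_eq G k)%N.
Proof. exact: (@rank_sig _ _ _ (fun k (i : 'I_(m k)) => (i < num_eq G k)%N)). Qed.

Lemma derive_xdir k (q : point) v :
  'D_v (lagrangian G (submxcol q.2.2 k) (pw q.1 k)) q.2.1 =
  'D_(xdir v) (lag k) q.
Proof.
case: q => p [x l] /=.
apply: (@derive_affine _ _ _ (fun y : blockvec R n => ((p, (y, l)) : point)) (lag k)).
by move=> h; congr (_, (_, _)); rewrite /= ?scaler0 ?add0r.
Qed.

Lemma fgrad_Rank k (a : 'I_(n k)) q :
  fgrad (tagnat.Rank k a) q =
  gradL G (submxcol q.2.2 k) (pw q.1 k) q.2.1 a 0 - pv q.1 k a 0.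
Proof. by rewrite /fgrad tagnat.Rank1K !mxE derive_xdir. Qed.

Lemma forall_Rank (q : 'I_N -> nat) (P : 'I_(\sum_k q k)%N -> Prop) :
  (forall a, P a) <-> forall k a, P (@tagnat.Rank _ q k a).
Proof. by split=> H // a; rewrite -(tagnat.sig2K a). Qed.

Lemma S_KKT_E : S_KKT G = kkt_system fgrad fcon feq.
Proof.
apply/funext => p; apply/seteqP; split=> -[x l] /=.
  move=> H; split.
    apply/forall_Rank => k a; rewrite fgrad_Rank /=.
    by have [-> _] := H k; rewrite subrr.
  apply/forall_Rank => k i; rewrite fcon_Rank feq_Rank -leqNgt.
  have [_ /(_ i)[h1 h2]] := H k; split=> [/h1|/h2[l0 g0 lg]].
    by rewrite /con/= => ->; rewrite subrr.
  by rewrite subr_le0; move: l0 lg; rewrite mxE.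
move=> [/forall_Rank H1 /forall_Rank H2] k; split.
  apply/colP => a; apply/esym/eqP; rewrite -subr_eq0; apply/eqP.
  by have := H1 k a; rewrite fgrad_Rank.
move=> i; have := H2 k i; rewrite fcon_Rank feq_Rank -leqNgt => -[h1 h2].
split=> [/h1|/h2[l0 g0 lg]]; first by move/subr0_eq.
by split; [rewrite mxE|rewrite -subr_le0|rewrite mxE].
Qed.

Lemma derive_const_slope (V : normedModType R) (f : V -> R) (x v : V) (c : R) :
  (forall h : R, f (h *: v + x) = h * c + f x) -> 'D_v f x = c.
Proof.
move=> fE; have := @derive_affine R V R f (@id R) x v c fE.
by rewrite derive_id.
Qed.

Lemma submxcol_delta (q : 'I_N -> nat) k (a : 'I_(\sum_k q k)%N) :
  tagnat.sig1 a != k -> submxcol (delta_mx a 0 : 'cV[R]_(\sum_k q k)%N) k = 0.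
Proof.
move=> ak; apply/colP => i; rewrite !mxE eqxx andbT.
by case: eqP => // e; move: ak; rewrite -e tagnat.Rank1K eqxx.
Qed.

Lemma submxcol_delta_Rank (q : 'I_N -> nat) k (a : 'I_(q k)) :
  submxcol (delta_mx (tagnat.Rank k a) 0 : 'cV[R]_(\sum_k q k)%N) k = delta_mx a 0.
Proof.
apply/colP => i; rewrite !mxE eqxx !andbT; congr (_%:R); congr nat_of_bool.
by rewrite -val_eqE tagnat.eq_Rank eqxx.
Qed.

Lemma con_xdir_out k (i : 'I_(m k)) a q :
  tagnat.sig1 a != k -> 'D_(xdir (delta_mx a 0)) (con i) q = 0.
Proof.
move=> ak; apply: derive_const_slope => h; rewrite mulr0 add0r /con.
congr (constr G i (_, _)); rewrite /= /pw submxcol_linear.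
  by rewrite submxcol_delta// scaler0 add0r.
by apply/colP => j; rewrite !mxE mulr0 add0r.
Qed.

Lemma lag_dual k (dl : blockvec R m) q :
  'D_(0, (0, dl)) (lag k) q = \sum_i submxcol dl k i 0 * con i q.
Proof.
apply: derive_const_slope => h; rewrite /lag /lagrangian.
rewrite /= /pw scaler0 add0r submxcol_linear.
have -> : submxcol (0 : blockvec R d) k = 0 by apply/colP => j; rewrite !mxE.
rewrite scaler0 add0r addrCA; congr (_ + _).
rewrite mulr_sumr -big_split/=; apply: eq_bigr => i _.
by rewrite submxcol_linear mxE [X in X + _]mxE mulrDl mulrA.
Qed.

End Flat.

Lemma diff_linear_expand (R : realType) (V : normedModType R) r
    (L : 'cV[R]_r -> V) (f : V -> R) (e w : V) (dx : 'cV[R]_r) :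
  linear L -> differentiable f e ->
  'd f e (L dx + w) = \sum_b dx b 0 * 'D_(L (delta_mx b 0)) f e + 'D_w f e.
Proof.
move=> lL df; pose LL : {linear 'cV[R]_r -> V} :=
  HB.pack L (GRing.isLinear.Build R _ _ *:%R L lL).
rewrite linearD deriveE//; congr (_ + _).
rewrite {1}[dx]matrix_sum_delta -[L]/(LL : _ -> _) !linear_sum.
apply: eq_bigr => b _; rewrite big_ord1 linearZ linearZ/= deriveE//.
Qed.

(** * Derivatives of the flattened system at the reference point *)

Section Reference.
Context {R : realType} {N : nat} {n m d : 'I_N -> nat} (G : nep R n m d).
Local Notation param := (blockvec R m * blockvec R n * blockvec R d)%type.
Local Notation point := (param * (blockvec R n * blockvec R m))%type.
Variables (p : param) (x : blockvec R n) (lam : blockvec R m).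
Let e0 : point := (p, (x, lam)).
Local Notation unit a := (xdir (m := m) (d := d) (R := R) (delta_mx a 0)).

(** Row [a] differentiates the Lagrangian of the player owning coordinate [a], so this is the
    Jacobian of the stacked gradients and in general not the Hessian of one function. *)
Definition flatH : 'M[R]_(\sum_k n k) :=
  \matrix_(a, b) 'D_(unit b) ('D_(unit a) (lag G (tagnat.sig1 a)) : point -> R) e0.

Definition flatJ : 'M[R]_(\sum_k m k, \sum_k n k) :=
  \matrix_(i, a) 'D_(unit a) (con G (tagnat.sig2 i)) e0.

Lemma diff_point (f : point -> R) (dx : blockvec R n) (dl : blockvec R m) :
  C1 f -> 'd f e0 (0, (dx, dl)) =
  \sum_b dx b 0 * 'D_(unit b) f e0 + 'D_(0, (0, dl)) f e0.
Proof.
move=> [df _].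
have lx : linear (fun v : blockvec R n => xdir v : point).
  by move=> c u v; congr (_, (_, _)); rewrite /= scaler0 addr0.
have <- := @diff_linear_expand R point _ _ f e0 (0, (0, dl)) dx lx (df e0).
by congr ('d f e0 _); congr (_, (_, _)); rewrite /= ?addr0 ?add0r.
Qed.

Lemma con_dual k (i : 'I_(m k)) (dl : blockvec R m) q :
  'D_(0, (0, dl)) (con G i) q = 0.
Proof.
apply: derive_const_slope => h; rewrite mulr0 add0r /con.
by congr (constr G i (_, _)); rewrite /= /pw scaler0 add0r.
Qed.

Lemma flatJ_Rank k (i : 'I_(m k)) a :
  flatJ (tagnat.Rank k i) a = 'D_(unit a) (con G i) e0.
Proof.
rewrite mxE.
exact: (@rank_sig _ _ _ (fun k (i : 'I_(m k)) => 'D_(unit a) (con G i) e0)).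
Qed.

(** The constraints of a player involve only the strategy of that player. This block structure lets
    the LICQ of the single players add up to that of the whole system. *)
Lemma flatJ_out k (i : 'I_(m k)) l (a : 'I_(n l)) : l != k ->
  flatJ (tagnat.Rank k i) (tagnat.Rank l a) = 0.
Proof. by move=> lk; rewrite flatJ_Rank con_xdir_out// tagnat.Rank1K. Qed.

Lemma flatJ_gradg k (i : 'I_(m k)) (a : 'I_(n k)) :
  flatJ (tagnat.Rank k i) (tagnat.Rank k a) =
  gradg G i (pw p k) (submxcol x k) a 0.
Proof.
rewrite flatJ_Rank mxE.
rewrite (@derive_affine _ _ _ (fun q : point => (submxcol q.2.1 k, submxcol q.1.2 k))
  (constr G i) e0 _ (delta_mx a 0, 0)); last first.
  move=> h /=; rewrite !submxcol_linear submxcol_delta_Rank.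
  by congr (_, _); apply/colP => j; rewrite !mxE ?mulr0 ?add0r.
rewrite (@derive_affine _ _ _ (fun y : 'cV[R]_(n k) => (y, pw p k)) (constr G i)
  (submxcol x k) _ (delta_mx a 0, 0))//.
by move=> h; congr (_, _); rewrite /= scaler0 add0r.
Qed.

Lemma flatJ_mul k (i : 'I_(m k)) (y : blockvec R n) :
  (flatJ *m y) (tagnat.Rank k i) 0 =
  ((gradg G i (pw p k) (submxcol x k))^T *m submxcol y k) 0 0.
Proof.
rewrite [LHS]mxE [RHS]mxE sum_rank (bigD1 k)//= [X in _ + X]big1 => [|l lk].
  rewrite addr0; apply: eq_bigr => a _; rewrite flatJ_gradg.
  by congr (_ * _); rewrite [RHS]mxE.
by rewrite big1// => a _; rewrite flatJ_out// mul0r.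
Qed.

Lemma flatJ_tr_mul k (a : 'I_(n k)) (mu : blockvec R m) :
  (flatJ^T *m mu) (tagnat.Rank k a) 0 =
  \sum_i submxcol mu k i 0 * gradg G i (pw p k) (submxcol x k) a 0.
Proof.
rewrite [LHS]mxE sum_rank (bigD1 k)//= [X in _ + X]big1 => [|l lk].
  rewrite addr0; apply: eq_bigr => i _; rewrite mulrC mxE; congr (_ * _).
    by rewrite mxE.
  by rewrite flatJ_gradg.
by rewrite big1// => i _; rewrite mxE flatJ_out 1?eq_sym// mul0r.
Qed.

(** [hessL] differentiates in [b] first, whereas linearizing the gradient differentiates in [a]
    first; symmetry of second derivatives reconciles the two orders. *)
Lemma hessL_lag l k j (a : 'I_(n k)) (b : 'I_(n j)) :
  hessL G p x lam l k j a b =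
  'D_(unit (tagnat.Rank j b)) ('D_(unit (tagnat.Rank k a)) (lag G l) : point -> R) e0.
Proof.
rewrite mxE [RHS]schwarz; last exact: lag_C2.
set g := 'D_(unit (tagnat.Rank j b)) (lag G l) : point -> R.
rewrite (_ : 'D_(dvar b) _ = fun y : blockvec R n => g (p, (y, lam))); last first.
  by apply/funext => y; exact: (derive_xdir G l (p, (y, lam))).
apply: (@derive_affine R _ point (fun y => (p, (y, lam))) g x (dvar a)) => h.
by congr (_, (_, _)); rewrite /= ?scaler0 ?add0r.
Qed.

Lemma flatH_hessL k j (a : 'I_(n k)) (b : 'I_(n j)) :
  flatH (tagnat.Rank k a) (tagnat.Rank j b) = hessL G p x lam k k j a b.
Proof.
have H := hessL_lag k a b.
transitivity ('D_(unit (tagnat.Rank j b))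
  ('D_(unit (tagnat.Rank k a)) (lag G k) : point -> R) e0); last exact: esym H.
by rewrite mxE tagnat.Rank1K.
Qed.

Lemma hessL_sym l k : (hessL G p x lam l k k)^T = hessL G p x lam l k k.
Proof.
apply/matrixP => a b; rewrite mxE.
have h1 := hessL_lag l b a; have h2 := hessL_lag l a b.
rewrite {}h1 {}h2; apply: schwarz; exact: lag_C2.
Qed.

Lemma flatH_form (y : blockvec R n) :
  qform flatH y =
  \sum_k \sum_j ((submxcol y k)^T *m hessL G p x lam k k j *m submxcol y j) 0 0.
Proof.
rewrite /qform -mulmxA mxE sum_rank; apply: eq_bigr => k _.
under [RHS]eq_bigr do rewrite -mulmxA mxE.
rewrite exchange_big/=; apply: eq_bigr => a _.
rewrite -mulr_sumr mxE; congr (_ * _); first by rewrite !mxE.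
rewrite mxE sum_rank; apply: eq_bigr => j _; rewrite mxE.
by apply: eq_bigr => b _; rewrite flatH_hessL; congr (_ * _); rewrite [RHS]mxE.
Qed.

Lemma dfcon i z : 'd (fcon G i) e0 (0, z) = (flatJ *m z.1) i 0.
Proof.
case: z => dx dl; rewrite diff_point; last exact: fcon_C1.
have dcon v : v.1 = 0 -> 'D_v (fcon G i) e0 = 'D_v (con G (tagnat.sig2 i)) e0.
  move=> v0; have lu : linear (fun q : point => - q.1.1.1 i 0).
    by move=> c u v'; rewrite /= !mxE opprD -mulrN.
  have fp := @finite_dim_point R N n m d.
  rewrite (_ : fcon G i = con G (tagnat.sig2 i) + (fun q : point => - q.1.1.1 i 0))//.
  rewrite deriveD; last 2 first.
  - by apply: diff_derivable; exact: (C2_C1 (con_C2 _ _)).1.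
  - by apply: diff_derivable; exact: (C1_lin fp lu).1.
  by rewrite (derive_lin _ _ fp lu) v0 /= mxE oppr0 addr0.
rewrite dcon// con_dual addr0 mxE; apply: eq_bigr => b _.
by rewrite dcon// mulrC mxE.
Qed.

Lemma dfgrad a z :
  'd (fgrad G a) e0 (0, z) = (flatH *m z.1 + flatJ^T *m z.2) a 0.
Proof.
case: z => dx dl; rewrite diff_point; last exact: fgrad_C1.
pose L := lag G (tagnat.sig1 a).
have dgr v : v.1 = 0 -> 'D_v (fgrad G a) e0 = 'D_v ('D_(unit a) L : point -> R) e0.
  move=> v0; have lu : linear (fun q : point => - q.1.1.2 a 0).
    by move=> c u v'; rewrite /= !mxE opprD -mulrN.
  have fp := @finite_dim_point R N n m d.
  rewrite (_ : fgrad G a = ('D_(unit a) L : point -> R) +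
    (fun q : point => - q.1.1.2 a 0))//.
  rewrite deriveD; last 2 first.
  - by apply: diff_derivable; exact: (C2_C1_derive _ (lag_C2 _ _)).1.
  - by apply: diff_derivable; exact: (C1_lin fp lu).1.
  by rewrite (derive_lin _ _ fp lu) v0 /= mxE oppr0 addr0.
rewrite dgr// [RHS]mxE; congr (_ + _).
  by rewrite mxE; apply: eq_bigr => b _; rewrite dgr// mulrC mxE.
(* Swapping the order puts the multiplier derivative inside; it is the combination of the
   constraints with coefficients [dl], whose gradient is the [J^T] block. *)
rewrite schwarz; last exact: lag_C2.
rewrite (_ : 'D_(0, (0, dl)) L = \sum_i submxcol dl (tagnat.sig1 a) i 0 *: con G i); last first.
  by apply/funext => q; rewrite lag_dual fct_sumE.
rewrite derive_sum => [|i]; last first.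
  by apply: diff_derivable; apply: differentiableZ; exact: (C2_C1 (con_C2 _ _)).1.
rewrite [RHS]mxE [RHS]sum_rank [RHS](bigD1 (tagnat.sig1 a))//=.
rewrite [X in _ = _ + X]big1 => [|l la]; last first.
  rewrite big1// => i _; rewrite mxE flatJ_Rank con_xdir_out ?mul0r//.
  by rewrite eq_sym.
rewrite addr0; apply: eq_bigr => i _.
rewrite deriveZ; last by apply: diff_derivable; exact: (C2_C1 (con_C2 _ _)).1.
by rewrite mxE [RHS]mulrC [in RHS]mxE flatJ_Rank.
Qed.

End Reference.

(** * Positive definiteness *)

Section MatrixForms.
Variable R : realType.

Lemma free_image_coef (K : fieldType) (vT : vectType K) (T : finType)
    (A : {pred T}) (f : T -> vT) (c : T -> K) :
  free [seq f i | i in A] -> \sum_(i in A) c i *: f i = 0 ->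
  forall i, i \in A -> c i = 0.
Proof.
move=> fr; rewrite -big_enum/= => sum0 i iA.
have iE : i \in enum A by rewrite mem_enum.
pose X := in_tuple [seq f i | i in A].
have /freeP/(_ (fun j : 'I_(size [seq f i | i in A]) => c (nth i (enum A) j))) h : free X by [].
have lt : (index i (enum A) < size [seq f i | i in A])%N.
  by rewrite size_map index_mem.
suff sumX : \sum_(j < size [seq f i | i in A]) c (nth i (enum A) j) *: X`_j = 0.
  by have := h sumX (Ordinal lt); rewrite /= nth_index.
rewrite -[RHS]sum0 (big_nth i) big_mkord.
rewrite -[in RHS](size_map f (enum A)).
apply: eq_bigr => j _; congr (_ *: _).
by rewrite /X /= (nth_map i)// -(size_map f).
Qed.

Lemma qformD r (P Q : 'M[R]_r) y : qform (P + Q) y = qform P y + qform Q y.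
Proof. by rewrite /qform mulmxDr mulmxDl mxE. Qed.

Lemma qformZ r (a : R) (Q : 'M[R]_r) y : qform (a *: Q) y = a * qform Q y.
Proof. by rewrite /qform -scalemxAr -scalemxAl mxE. Qed.

Lemma qform_congr r r' (Q : 'M[R]_r) (C : 'M[R]_(r, r')) y :
  qform (C^T *m Q *m C) y = qform Q (C *m y).
Proof. by rewrite /qform trmx_mul !mulmxA. Qed.

Lemma posdef_unitmx r (Q : 'M[R]_r) :
  (forall y, y != 0 -> 0 < qform Q y) -> Q \in unitmx.
Proof.
move=> Qpos; rewrite -row_free_unit -kermx_eq0; apply/eqP/row_matrixP => i.
rewrite row0; apply/eqP; apply: contraT => v0.
have vQ : row i (kermx Q) *m Q = 0 by apply/sub_kermxP; exact: row_sub.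
have := Qpos (row i (kermx Q))^T; rewrite /qform trmxK vQ mul0mx mxE ltxx => h.
by apply: h; rewrite -(inj_eq (@trmx_inj _ _ _)) trmxK trmx0.
Qed.

(** The expression equals [a * qform Q u] for [u = c + (2 a)^-1 Q^-1 b]; symmetry of [Q] merges the
    two cross terms. *)
Lemma complete_square r (Q : 'M[R]_r) (a : R) (b c : 'cV[R]_r) :
  Q^T = Q -> (forall y, y != 0 -> 0 < qform Q y) -> 0 < a ->
  0 <= a * qform Q c + (c^T *m b) 0 0 + (4 * a)^-1 * qform (invmx Q) b.
Proof.
move=> Qsym Qpos a0.
have Qu := posdef_unitmx Qpos.
have Q0 y : 0 <= qform Q y.
  have [->|/Qpos/ltW//] := eqVneq y 0.
  by rewrite /qform mulmx0 mxE.
pose u := c + (2 * a)^-1 *: (invmx Q *m b).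
suff -> : a * qform Q c + (c^T *m b) 0 0 + (4 * a)^-1 * qform (invmx Q) b =
    a * qform Q u by rewrite mulr_ge0// ltW.
have iQ : (invmx Q)^T = invmx Q by rewrite trmx_inv Qsym.
have bc : (b^T *m c) 0 0 = (c^T *m b) 0 0.
  by rewrite -[b^T *m c]trmxK trmx_mul trmxK mxE.
have uT : u^T = c^T + (2 * a)^-1 *: (b^T *m invmx Q).
  by rewrite /u linearD/=; congr (_ + _); rewrite linearZ/= trmx_mul iQ.
have QuE : Q *m u = Q *m c + (2 * a)^-1 *: b.
  by rewrite /u mulmxDr -scalemxAr mulKVmx.
have cQc : c^T *m Q *m c = c^T *m (Q *m c) by rewrite mulmxA.
rewrite /qform -[u^T *m Q *m u]mulmxA QuE uT mulmxDl !mulmxDr -!scalemxAl -!scalemxAr.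
rewrite [b^T *m invmx Q *m (Q *m c)]mulmxA mulmxKV// cQc.
move: bc; move: (b^T *m c) (c^T *m b) (c^T *m (Q *m c)) (b^T *m invmx Q *m b) => X Y Z W XY.
rewrite !mxE XY; field.
by rewrite gt_eqF//= ?mulr_gt0.
Qed.

Lemma span_image_mulmx r s (B : 'M[R]_(r, s)) (y : 'cV[R]_r) :
  y \in <<[seq col j B | j : 'I_s]>>%VS <-> exists c, y = B *m c.
Proof.
split=> [ys|[c ->]].
  have H (i : 'I_(size [seq col j B | j : 'I_s])) :
      exists c : 'cV[R]_s, [seq col j B | j : 'I_s]`_i = B *m c.
    have /mapP[j _ ->] : [seq col j B | j : 'I_s]`_i \in [seq col j B | j : 'I_s].
      by rewrite mem_nth.
    by exists (delta_mx j 0); rewrite colE.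
  have [c cE] := choice H.
  have ys' : y \in <<in_tuple [seq col j B | j : 'I_s]>>%VS by [].
  exists (\sum_i coord (in_tuple [seq col j B | j : 'I_s]) i y *: c i).
  rewrite [LHS](coord_span ys') mulmx_sumr; apply: eq_bigr => i _.
  by rewrite -scalemxAr -cE.
have -> : B *m c = \sum_j c j 0 *: col j B.
  apply/colP => i; rewrite summxE mxE; apply: eq_bigr => j _.
  by rewrite !mxE mulrC.
apply: memv_suml => j _; apply: memvZ; apply: memv_span.
by apply: map_f; rewrite mem_enum.
Qed.

Lemma free_cols_inj r s (B : 'M[R]_(r, s)) (c : 'cV[R]_s) :
  free [seq col j B | j : 'I_s] -> B *m c = 0 -> c = 0.
Proof.
move=> fB Bc; apply/colP => j; rewrite mxE.
apply: (free_image_coef (c := fun j => c j 0) fB) => //.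
rewrite -[RHS]Bc; apply/colP => i; rewrite summxE mxE.
by apply: eq_big => // k _; rewrite !mxE mulrC.
Qed.

End MatrixForms.

(** * From the hypotheses on the players to the whole system *)

Section Hypotheses.
Context {R : realType} {N : nat} {n m d : 'I_N -> nat} (G : nep R n m d).
Variables (p : blockvec R m * blockvec R n * blockvec R d).
Variables (x : blockvec R n) (lam : blockvec R m).
Variables (B : forall k, 'M[R]_(n k, n k - #|I1 G p x lam k|)).
Local Notation H := (hessL G p x lam).
Local Notation A := (crossA G p x lam).
Local Notation M k := (critM G p x lam k).

Hypothesis kkt : S_KKT G p (x, lam).
Hypothesis licq : forall k, LICQ G p x lam k.
Hypothesis basisB : forall k, is_basis_matrix (B k).
Hypothesis ssosc : forall k, SSOSC G p x lam k.

Lemma hess_ge0 k y : M k y -> 0 <= qform (H k k k) y.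
Proof.
move=> My; have [->|y0] := eqVneq y 0; first by rewrite /qform mulmx0 mxE.
exact/ltW/(ssosc My y0).
Qed.

Lemma reduced_hess_pos k c : c != 0 ->
  0 < qform ((B k)^T *m H k k k *m B k) c.
Proof.
have [fB MB] := basisB k.
move=> c0; rewrite qform_congr; apply: ssosc.
  by rewrite MB/=; apply/span_image_mulmx; exists c.
by apply: contra c0 => /eqP/(free_cols_inj fB)/eqP.
Qed.

(** Writing [yi = B i *m c], the square is completed in [c] for the reduced Hessian, with linear
    term [(B i)^T *m A i k *m yk]. *)
Lemma coupling_bound i k (a : R) yi (yk : 'cV[R]_(n k)) : 0 < a -> M i yi ->
  0 <= a * qform (H i i i) yi + (yi^T *m A i k *m yk) 0 0 +
    (4 * a)^-1 * qform ((A i k)^T *m B i *m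
      invmx ((B i)^T *m H i i i *m B i) *m (B i)^T *m A i k) yk.
Proof.
move=> a0; have [fB ->] := basisB i => /span_image_mulmx[c ->].
have sym : ((B i)^T *m H i i i *m B i)^T = (B i)^T *m H i i i *m B i.
  by rewrite !trmx_mul trmxK hessL_sym mulmxA.
have := complete_square ((B i)^T *m A i k *m yk) c sym (@reduced_hess_pos i) a0.
rewrite qform_congr -qform_congr.
congr (0 <= _); congr (_ + _ + _ * _).
  by rewrite trmx_mul !mulmxA.
rewrite -qform_congr; congr (qform _ _).
by rewrite trmx_mul trmxK !mulmxA.
Qed.

Variable alpha : 'I_N -> 'I_N -> R.
Hypothesis alpha_gt0 : forall i j, j != i -> 0 < alpha i j.
Hypothesis alpha_sum : forall i, \sum_(j | j != i) alpha i j = 1.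
Hypothesis dominance : forall i k, i != k -> forall y, M k y -> y != 0 ->
  0 < qform (H k k k - (4 * alpha i k * alpha k i)^-1 *:
     ((A i k)^T *m B i *m invmx ((B i)^T *m H i i i *m B i)
        *m (B i)^T *m A i k)) y.

(** Multiplied by [alpha k i], the subtracted term of the dominance condition gets the coefficient
    [(4 * alpha i k)^-1], exactly the defect in [coupling_bound] for [a = alpha i k]. *)
Lemma pair_form_gt0 i k yi yk : i != k -> M i yi -> M k yk -> yk != 0 ->
  0 < alpha i k * qform (H i i i) yi + alpha k i * qform (H k k k) yk +
      (yi^T *m A i k *m yk) 0 0.
Proof.
move=> ik Mi Mk yk0.
have a1 : 0 < alpha i k by apply: alpha_gt0; rewrite eq_sym.
have a2 : 0 < alpha k i by exact: alpha_gt0.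
have := coupling_bound yk a1 Mi; have := dominance ik Mk yk0.
rewrite qformD -scaleNr qformZ.
move: (qform _ yk) => Q; move: (qform _ yk) (qform _ yi) => qk qi.
rewrite -(pmulr_rgt0 _ a2) mulrDr mulNr mulrN mulrA.
have -> : alpha k i * (4 * alpha i k * alpha k i)^-1 = (4 * alpha i k)^-1.
  by field; rewrite !gt_eqF.
lra.
Qed.

Lemma pair_form_ge0 i k yi yk : i != k -> M i yi -> M k yk ->
  0 <= alpha i k * qform (H i i i) yi + alpha k i * qform (H k k k) yk +
      (yi^T *m A i k *m yk) 0 0.
Proof.
move=> ik Mi Mk; have [->|yk0] := eqVneq yk 0; last exact/ltW/pair_form_gt0.
have -> : qform (H k k k) 0 = 0 by rewrite /qform mulmx0 mxE.
have -> : (yi^T *m A i k *m (0 : 'cV_(n k))) 0 0 = 0 by rewrite mulmx0 mxE.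
rewrite mulr0 !addr0 mulr_ge0 ?hess_ge0//.
by apply/ltW/alpha_gt0; rewrite eq_sym.
Qed.

(** The weights [alpha i k] distribute the diagonal form of player [i] among the opponents. As they
    sum to one, the pair forms [S i k] over ordered pairs add up to twice the full form. *)
Lemma block_form_gt0 (y : forall k, 'cV[R]_(n k)) k0 :
  (forall k, M k (y k)) -> y k0 != 0 ->
  0 < \sum_k \sum_j ((y k)^T *m H k k j *m y j) 0 0.
Proof.
move=> My yk0.
pose q k := qform (H k k k) (y k).
pose Y i k := ((y i)^T *m H i i k *m y k) 0 0.
pose S i k := alpha i k * q i + alpha k i * q k + (Y i k + Y k i).
have YA i k : ((y i)^T *m A i k *m y k) 0 0 = Y i k + Y k i.
  rewrite /A mulmxDr mulmxDl mxE; congr (_ + _).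
  have tr11 (M : 'M[R]_1) : M 0 0 = M^T 0 0 by rewrite mxE.
  by rewrite [RHS]tr11 !trmx_mul trmxK mulmxA.
have swap (f : 'I_N -> 'I_N -> R) :
    \sum_i \sum_(k | k != i) f k i = \sum_i \sum_(k | k != i) f i k.
  rewrite (exchange_big_dep predT)//=; apply: eq_bigr => i _.
  by apply: eq_bigl => k; rewrite eq_sym.
have sumq : \sum_i \sum_(k | k != i) alpha i k * q i = \sum_i q i.
  by apply: eq_bigr => i _; rewrite -mulr_suml alpha_sum mul1r.
have total : \sum_i \sum_(k | k != i) S i k =
    2 * \sum_k \sum_j ((y k)^T *m H k k j *m y j) 0 0.
  under eq_bigr do rewrite !big_split/=.
  rewrite !big_split/= sumq (swap (fun k i => alpha k i * q k)) sumq.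
  rewrite (swap Y).
  have -> : \sum_k \sum_j ((y k)^T *m H k k j *m y j) 0 0 =
      \sum_i (q i + \sum_(k | k != i) Y i k).
    by apply: eq_bigr => i _; rewrite (bigD1 i).
  by rewrite big_split/=; ring.
rewrite -(pmulr_rgt0 _ (_ : 0 < 2))// -total.
have S0 i k : k != i -> 0 <= S i k.
  by move=> ki; rewrite /S -YA; apply: pair_form_ge0 => //; rewrite eq_sym.
(* An opponent of [k0] exists because the weights of [k0] sum to one, which an empty sum does not;
   the pair with that opponent makes the total strictly positive. *)
have [i ik0] : exists i, i != k0.
  apply: contrapT => Hn; have := alpha_sum k0.
  rewrite big1 => [/eqP|i ik]; first by rewrite eq_sym oner_eq0.
  by case: Hn; exists i.
rewrite (bigD1 i)//= (bigD1 k0) 1?eq_sym//= -addrA ltr_wpDr//.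
  rewrite addr_ge0// sumr_ge0// => j.
    by case/andP => ji _; exact: S0.
  by move=> _; apply: sumr_ge0 => k; exact: S0.
by rewrite /S -YA; exact: pair_form_gt0.
Qed.

Local Notation sact := (strongly_active (feq G) (x, lam)).
Local Notation wact := (weakly_active (fcon G) (feq G) p (x, lam)).

(** [I1] also tests the slack; at a KKT point complementarity supplies that test. *)
Lemma sact_I1 k (i : 'I_(m k)) : sact (tagnat.Rank k i) = (i \in I1 G p x lam k).
Proof.
rewrite inE /strongly_active feq_Rank /= !mxE.
have [i_eq|i_ineq] := boolP (i < num_eq G k)%N => //=.
rewrite leqNgt i_ineq/=; have [l0|//] := ltP 0 _; rewrite /=.
have [_ /(_ i)[_]] := kkt k; rewrite leqNgt => /(_ i_ineq)[_ _ /eqP].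
by rewrite mxE mulf_eq0 gt_eqF.
Qed.

Lemma wact_I2 k (i : 'I_(m k)) : wact (tagnat.Rank k i) = (i \in I2 G p x lam k).
Proof.
rewrite inE /weakly_active /strongly_active feq_Rank /= fcon_Rank negb_or -leqNgt.
rewrite -andbA /slack !mxE.
have [i_ineq|//] := boolP (num_eq G k <= i)%N => /=.
have [_ /(_ i)[_ /(_ i_ineq)[+ _ _]]] := kkt k; rewrite mxE /= => l0.
by rewrite -leNgt; congr (_ && _); rewrite eq_le l0 andbT.
Qed.

Lemma flat_licq (mu : blockvec R m) :
  (forall i, ~~ sact i -> ~~ wact i -> mu i 0 = 0) ->
  (flatJ G p x lam)^T *m mu = 0 -> mu = 0.
Proof.
move=> mu0 Jmu; apply/colP; apply/forall_Rank => k i; rewrite mxE.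
have off j : j \notin I1 G p x lam k :|: I2 G p x lam k ->
    mu (tagnat.Rank k j) 0 = 0.
  by rewrite finset.in_setU negb_or => /andP[j1 j2]; apply: mu0; rewrite ?sact_I1 ?wact_I2.
have [iA|/off//] := boolP (i \in I1 G p x lam k :|: I2 G p x lam k).
apply: (free_image_coef (c := fun j => mu (tagnat.Rank k j) 0) (licq k)) iA.
apply/colP => a; rewrite [RHS]mxE.
have : ((flatJ G p x lam)^T *m mu) (tagnat.Rank k a) 0 = 0 by rewrite Jmu mxE.
rewrite flatJ_tr_mul (bigID (mem (I1 G p x lam k :|: I2 G p x lam k)))/=.
rewrite [X in _ + X]big1 => [|j jA]; last by rewrite mxE off// mul0r.
rewrite addr0 summxE => e; rewrite -[RHS]e; apply: eq_bigr => j _.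
by rewrite mxE; congr (_ * _); rewrite mxE.
Qed.

Lemma flat_critM (y : blockvec R n) :
  (forall i, sact i -> (flatJ G p x lam *m y) i 0 = 0) ->
  forall k, M k (submxcol y k).
Proof.
move=> Jy k i; rewrite -sact_I1 => /Jy; rewrite flatJ_mul => e.
by apply/matrixP => a b; rewrite !ord1 e mxE.
Qed.

Lemma flat_posdef (y : blockvec R n) : y != 0 ->
  (forall i, sact i -> (flatJ G p x lam *m y) i 0 = 0) ->
  0 < qform (flatH G p x lam) y.
Proof.
move=> y0 /flat_critM My; rewrite flatH_form.
have [k yk0] : exists k, submxcol y k != 0.
  apply: contrapT => Hn; move/eqP: y0; apply; apply/mxcolP => k.
  rewrite submxcol0; apply/eqP; apply: contraT => yk.
  by case: Hn; exists k.
exact: (block_form_gt0 My yk0).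
Qed.

Lemma kkt_lipschitz : lipschitz_localization (S_KKT G) p (x, lam).
Proof.
rewrite S_KKT_E.
apply: (@kkt_localization _ _ _ _ _ _ _ _ _ (flatH G p x lam) (flatJ G p x lam)).
- exact: finite_dim_param.
- exact: fgrad_C1.
- exact: fcon_C1.
- by move=> i z; exact: dfgrad.
- by move=> i z; exact: dfcon.
- by rewrite -S_KKT_E.
- exact: flat_licq.
- exact: flat_posdef.
Qed.

End Hypotheses.

(** * Local Nash equilibria *)

(* [s] is the decrease of the constraints along [v], [g] its first-order part
   up to sign, and [l] the multipliers. *)
Lemma second_order_growth (R : realType) (I : finType) (J : {pred I}) (l s g : I -> R)
    (kap c eps t hv nv nn : R) :
  0 <= kap -> 0 <= nv -> 0 <= nn -> 0 < t < 1 -> 0 <= eps <= 1 ->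
  eps * (2 * kap * #|J|%:R + nn) <= c ->
  c * nv ^+ 2 <= hv + kap * \sum_(i in J) g i ^+ 2 ->
  (forall i, `|- s i - g i| <= eps * nv) ->
  (forall i, 0 <= l i * s i) ->
  (forall i, i \in J -> 2 * kap * s i ^+ 2 <= l i * s i) ->
  0 <= t * hv - eps * t * nn * nv ^+ 2 + \sum_i l i * s i.
Proof.
move=> k0 nv0 nn0 /andP[t0 t1] /andP[eps0 eps1] epsc fin sg ls0 lsJ.
(* From [g = - s - (- s - g)] and the inequality between the square of a sum and twice the sum of
   squares; [eps <= 1] replaces [eps^2] by [eps]. *)
have gle i : g i ^+ 2 <= 2 * s i ^+ 2 + 2 * eps * nv ^+ 2.
  have e1 : (- s i - g i) ^+ 2 <= (eps * nv) ^+ 2.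
    by rewrite -(real_normK (num_real (- s i - g i))) ler_sqr ?nnegrE ?mulr_ge0.
  have e2 : (eps * nv) ^+ 2 <= eps * nv ^+ 2.
    by rewrite exprMn ler_wpM2r ?sqr_ge0// expr2 ler_piMr.
  have := sqr_ge0 (- s i * 2 - g i); nra.
have sumg : kap * \sum_(i in J) g i ^+ 2 <=
    \sum_(i in J) l i * s i + 2 * kap * #|J|%:R * eps * nv ^+ 2.
  rewrite mulr_sumr (_ : 2 * kap * #|J|%:R * eps * nv ^+ 2 =
    \sum_(i in J) kap * (2 * eps * nv ^+ 2)); last first.
    by rewrite sumr_const -mulr_natr; ring.
  rewrite -big_split/=; apply: ler_sum => i iJ.
  have := lsJ i iJ; have := ler_wpM2l k0 (gle i); rewrite mulrDr; lra.
have sumJ : \sum_(i in J) l i * s i <= \sum_i l i * s i.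
  by rewrite [leRHS](bigID (mem J))/= lerDl sumr_ge0.
have S0 : 0 <= \sum_i l i * s i by apply: sumr_ge0.
have nv2 : 0 <= nv ^+ 2 by exact: sqr_ge0.
have := ler_wpM2r nv2 epsc.
move: sumJ S0 sumg fin; move: (\sum_(i in J) l i * s i) (\sum_i l i * s i)
  (\sum_(i in J) g i ^+ 2) (nv ^+ 2) => SJ S gg n2 h1 h2 h3 h4 h5.
have h6 : 0 <= hv - eps * nn * n2 + S.
  by move: h5; rewrite mulrDr mulrDl; lra.
(* The curvature carries the mean value factor [t] but the multiplier sum [S] does not; since
   [S >= 0], the rest of [S] only helps. *)
have : 0 <= t * (hv - eps * nn * n2 + S) + (1 - t) * S.
  by rewrite addr_ge0 ?mulr_ge0// ?subr_ge0 ltW.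
lra.
Qed.

Section LocalMin.
Context {R : realType} {N : nat} {n m d : 'I_N -> nat} (G : nep R n m d).
Local Notation param := (blockvec R m * blockvec R n * blockvec R d)%type.
Local Notation point := (param * (blockvec R n * blockvec R m))%type.

Lemma submxcol_deviation (x : blockvec R n) k (z : 'cV[R]_(n k)) :
  submxcol (deviation x z) k = z.
Proof. by rewrite /deviation mxcolK eqtype.dfwith_in. Qed.

Lemma submxcol_deviation_out (x : blockvec R n) k (z : 'cV[R]_(n k)) j :
  k != j -> submxcol (deviation x z) j = submxcol x j.
Proof. by move=> kj; rewrite /deviation mxcolK eqtype.dfwith_out. Qed.

Lemma deviationE (x : blockvec R n) k (z : 'cV[R]_(n k)) :
  deviation x z = x + deviation 0 (z - submxcol x k).
Proof.
apply/mxcolP => j; rewrite submxcolD.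
have [<-|kj] := eqVneq k j.
  by rewrite !submxcol_deviation addrC subrK.
by rewrite !submxcol_deviation_out// submxcol0 addr0.
Qed.

Lemma deviation_sum k (v : 'cV[R]_(n k)) (f : 'I_(\sum_k n k)%N -> R) :
  \sum_b deviation 0 v b 0 * f b = \sum_b v b 0 * f (tagnat.Rank k b).
Proof.
rewrite sum_rank (bigD1 k)//= [X in _ + X]big1 => [|j jk].
  rewrite addr0; apply: eq_bigr => b _; congr (_ * _).
  by rewrite -[in RHS](submxcol_deviation 0 v) [RHS]mxE.
rewrite big1// => b _.
have /colP/(_ b) : submxcol (deviation 0 v) j = 0.
  by rewrite submxcol_deviation_out 1?eq_sym// submxcol0.
by rewrite [LHS]mxE [RHS]mxE => ->; rewrite mul0r.
Qed.

Lemma norm_deviation0 k (v : 'cV[R]_(n k)) : `|deviation 0 v| <= `|v|.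
Proof.
apply: mx_norm_le => // + j; rewrite (ord1 j); apply/forall_Rank => l a.
have -> : deviation 0 v (tagnat.Rank l a) 0 = submxcol (deviation 0 v) l a 0.
  by rewrite [RHS]mxE.
have [e|kl] := eqVneq k l.
  by move: a; rewrite -e => a; rewrite submxcol_deviation mx_entry_le.
by rewrite submxcol_deviation_out// submxcol0 mxE normr0.
Qed.

Lemma norm_xdir (v : blockvec R n) : `|xdir v : point| <= `|v|.
Proof.
rewrite prod_normE ge_max [xdir v]/xdir/= normr0 normr_ge0/=.
by rewrite prod_normE ge_max/= lexx normr0 normr_ge0.
Qed.

Variables (p : param) (x : blockvec R n) (lam : blockvec R m).
Let e0 : point := (p, (x, lam)).
Local Notation H := (hessL G p x lam).
Local Notation unit a := (xdir (m := m) (d := d) (R := R) (delta_mx a 0)).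
Local Notation A k a := ('D_(unit (tagnat.Rank k a)) (lag G k) : point -> R).

Lemma diff_grad k (a : 'I_(n k)) (v : 'cV[R]_(n k)) :
  'd (A k a) e0 (xdir (deviation 0 v)) = (H k k k *m v) a 0.
Proof.
have CA : C1 (A k a) by exact: C2_C1_derive (lag_C2 G k).
rewrite /xdir (@diff_point R N n m d p x lam (A k a) _ 0 CA).
have -> : 'D_(0, (0, 0)) (A k a) (p, (x, lam)) = 0 by exact: derive0.
rewrite addr0 deviation_sum mxE; apply: eq_bigr => b _; rewrite mulrC; congr (_ * _).
by have := hessL_lag G p x lam k a b.
Qed.

Lemma diff_con k (i : 'I_(m k)) (v : 'cV[R]_(n k)) :
  'd (con G i) e0 (xdir (deviation 0 v)) =
  ((gradg G i (pw p k) (submxcol x k))^T *m v) 0 0.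
Proof.
have CA : C1 (con G i) by exact: C2_C1 (con_C2 G i).
rewrite /xdir (@diff_point R N n m d p x lam (con G i) _ 0 CA).
rewrite con_dual addr0 -[in RHS](submxcol_deviation 0 v) -(flatJ_mul _ _ _ lam) mxE.
by apply: eq_bigr => b _; rewrite flatJ_Rank mulrC.
Qed.

Lemma near_pair_ball (P : point * point -> Prop) :
  (\forall q \near (e0, e0), P q) ->
  exists2 r, 0 < r & forall q q', ball e0 r q -> ball e0 r q' -> P (q, q').
Proof.
by move=> /nbhs_ballP[r /= r0 rP]; exists r => // q q' h h'; apply: rP.
Qed.

(** The penalty vanishes exactly on the critical subspace, where the SSOSC makes the Hessian form
    positive. *)
Lemma finsler_block k : SSOSC G p x lam k ->
  exists kap c : R, [/\ 0 <= kap, 0 < c & forall v : 'cV[R]_(n k),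
    c * `|v| ^+ 2 <= qform (H k k k) v + kap *
      \sum_(i in I1 G p x lam k)
         ((gradg G i (pw p k) (submxcol x k))^T *m v) 0 0 ^+ 2].
Proof.
move=> ss.
have fd := finite_dim_cV R (n k).
have Cl r (M : 'M[R]_(r, n k)) i : C1 (fun v : 'cV[R]_(n k) => (M *m v) i 0).
  apply: C1_lin => // c u v.
  by rewrite mulmxDr -scalemxAr; move: (M *m u) (M *m v) => w1 w2; rewrite !mxE.
have Ce i : C1 (fun v : 'cV[R]_(n k) => v i 0).
  by apply: C1_lin => // c u v; rewrite !mxE.
have qE v : qform (H k k k) v = \sum_i v i 0 * (H k k k *m v) i 0.
  by rewrite /qform -mulmxA mxE; apply: eq_bigr => i _; rewrite mxE.
apply: finsler.
- have -> : qform (H k k k) = fun v => \sum_i v i 0 * (H k k k *m v) i 0.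
    by apply/funext => v; exact: qE.
  apply: C1_continuous.
  by apply: C1_sum => i _; apply: C1M; [exact: Ce|exact: Cl].
- apply: C1_continuous; apply: C1_sum => i _; apply: C1M; exact: Cl.
- move=> a y; rewrite /qform; have -> : (a *: y)^T = a *: y^T by exact: linearZ.
  by rewrite -scalemxAr -!scalemxAl scalerA mxE.
- move=> a y; rewrite mulr_sumr; apply: eq_bigr => i _.
  by rewrite -scalemxAr mxE exprMn.
- by move=> y; apply: sumr_ge0 => i _; exact: sqr_ge0.
- move=> y y0 /eqP; rewrite psumr_eq0 => [/allP h|i _]; last exact: sqr_ge0.
  apply: ss => // i iI; have := h i (mem_index_enum i); rewrite iI /= sqrf_eq0 => /eqP e.
  by apply/matrixP => a b; rewrite !ord1 e mxE.
Qed.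

(** A first-order mean value, with one [t] for all components. Together with strict
    differentiability of the gradient at the reference point it replaces a Taylor expansion at [q],
    whose Hessian would vary with [q]. *)
Lemma lag_mean_value k (q : point) (v : 'cV[R]_(n k)) :
  exists2 t, 0 < t < 1 &
    lag G k (q + xdir (deviation 0 v)) - lag G k q =
    \sum_a v a 0 * A k a (q + t *: xdir (deviation 0 v)).
Proof.
have dl q' : differentiable (lag G k) q' by exact: (C2_C1 (lag_C2 G k)).1.
have [t t01 ->] := mean_value_line q (xdir (deviation 0 v)) dl.
exists t => //; set q' := q + _.
have lx : linear (fun v : blockvec R n => xdir v : point).
  by move=> c u w; congr (_, (_, _)); rewrite /= scaler0 addr0.
have := @diff_linear_expand R point _ _ (lag G k) q' 0 (deviation 0 v) lx (dl q').
by rewrite addr0 derive0 addr0 deviation_sum deriveE// => ->.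
Qed.

Lemma lag_objective k (q : point) (z : 'cV[R]_(n k)) :
  lag G k (q + xdir (deviation 0 (z - submxcol q.2.1 k))) =
  objective G q.1 q.2.1 z + \sum_a pv q.1 k a 0 * z a 0 +
  \sum_i submxcol q.2.2 k i 0 * constr G i (z, pw q.1 k).
Proof.
case: q => p' [x' l'] /=; rewrite /lag /lagrangian /= /objective subrK.
by rewrite !addr0 -deviationE submxcol_deviation.
Qed.

(** One radius serves all pairs of nearby points, which makes the final neighborhood uniform over
    KKT points. The third estimate persists because at the reference pair its left side is zero and
    its right side positive. *)
Lemma uniform_estimates k (eps kap : R) : 0 < eps ->
  exists2 r, 0 < r & forall q q' : point, ball e0 r q -> ball e0 r q' ->
   [/\ forall a, `|A k a q - A k a q' - 'd (A k a) e0 (q - q')| <= eps * `|q - q'|,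
       forall i : 'I_(m k), `|con G i q - con G i q' - 'd (con G i) e0 (q - q')| <=
         eps * `|q - q'|
     & forall i : 'I_(m k), 0 < submxcol lam k i 0 ->
         2 * kap * (con G i q' - con G i q) < submxcol q'.2.2 k i 0].
Proof.
move=> eps0; have fp := @finite_dim_point R N n m d.
have fpp := finite_dim_prod fp fp.
have N1 : \forall q \near (e0, e0), forall a : 'I_(n k),
    `|A k a q.1 - A k a q.2 - 'd (A k a) e0 (q.1 - q.2)| <= eps * `|q.1 - q.2|.
  apply: (@filter_forall _ _ _ (nbhs (e0, e0)) (nbhs_filter _)) => a.
  by apply: C1_strict => //; exact: C2_C1_derive (lag_C2 G k).
have N2 : \forall q \near (e0, e0), forall i : 'I_(m k),
    `|con G i q.1 - con G i q.2 - 'd (con G i) e0 (q.1 - q.2)| <= eps * `|q.1 - q.2|.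
  apply: (@filter_forall _ _ _ (nbhs (e0, e0)) (nbhs_filter _)) => i.
  by apply: C1_strict => //; exact: C2_C1 (con_C2 G i).
have N3 : \forall q \near (e0, e0), forall i : 'I_(m k),
    0 < submxcol lam k i 0 ->
    2 * kap * (con G i (q : point * point).2 - con G i q.1) < submxcol q.2.2.2 k i 0.
  apply: (@filter_forall _ _ (fun (i : 'I_(m k)) (q : point * point) =>
    0 < submxcol lam k i 0 ->
    2 * kap * (con G i q.2 - con G i q.1) < submxcol q.2.2.2 k i 0)
    (nbhs (e0, e0)) (nbhs_filter _)) => i.
  have [l0|l0] := ltP 0 (submxcol lam k i 0); last by apply: nearW => q.
  have Cc := C2_C1 (con_C2 G i).
  have C1l : C1 (fun q : point * point => con G i q.1).
    by apply: (C1_comp_lin (l := fst) fpp _ Cc).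
  have C2l : C1 (fun q : point * point => con G i q.2).
    by apply: (C1_comp_lin (l := snd) fpp _ Cc).
  have C3 : C1 (fun q : point * point => submxcol q.2.2.2 k i 0).
    by apply: C1_lin => // c u v; rewrite /= !mxE.
  have C4 : C1 (fun q : point * point => 2 * kap * (con G i q.2 - con G i q.1)).
    exact: (C1M (C1_cst _ _) (C1D C2l (C1N C1l))).
  have lt0 : 2 * kap * (con G i (e0, e0).2 - con G i (e0, e0).1) <
    submxcol (e0, e0).2.2.2 k i 0 by rewrite subrr mulr0.
  have := near_lt_cont C4 C3 lt0.
  by apply: filterS => q hq _.
have [r r0 rP] := near_pair_ball (filterI N1 (filterI N2 N3)).
by exists r => // q q' /rP h /h [h1 [h2 h3]].
Qed.

(** The objective increment from [xk] to [z] is the Lagrangian increment minus the term linear in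
    [pv], plus [\sum_i lamk i 0 * s i]. The first two are bounded below by curvature at the
    reference point, whose possible deficit the last sum compensates. *)
Lemma kkt_local_minimizer k : SSOSC G p x lam k ->
  \forall q \near e0, S_KKT G q.1 q.2 ->
    local_minimizer (feasible G q.1 k) (objective G q.1 q.2.1 (k := k))
      (submxcol q.2.1 k).
Proof.
move=> ss; have [kap [c [k0 c0 fin]]] := finsler_block ss.
(* The error budget in units of [eps * |v|^2]: linearizing the penalized constraints costs the first
   summand, linearizing the [n k] gradient components the second. The choice of [eps] below keeps
   the total within [c]. *)
pose M := 2 * kap * #|I1 G p x lam k|%:R + (n k)%:R.
have M0 : 0 <= M by rewrite addr_ge0 ?mulr_ge0.
pose eps := c / (M + c).
have Mc0 : 0 < M + c by rewrite ltr_wpDl.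
have eps0 : 0 < eps by rewrite divr_gt0.
have eps1 : eps <= 1 by rewrite /eps ler_pdivrMr// mul1r lerDr.
have epsM : eps * M <= c by rewrite /eps mulrAC ler_pdivrMr// ler_pM2l// lerDl ltW.
have [r r0 est] := uniform_estimates k kap eps0.
(* Half of [r] is left for the distance from [q] to the competitor [z], so the whole segment from
   [q] to [q + D] stays in the ball of radius [r]. *)
apply/nbhs_ballP; exists (r / 2) => /=; first by rewrite divr_gt0.
move=> q bq Kq; have [vE gE] := Kq k.
set xk := submxcol q.2.1 k in vE gE *.
set lamk := submxcol q.2.2 k in vE gE *.
split.
  move=> i; have [h1 h2] := gE i; split=> [/h1//|/h2[]//].
apply/nbhs_ballP; exists (r / 2) => /=; first by rewrite divr_gt0.
move=> z; rewrite -ball_normE/= distrC => bz fz.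
pose v := z - xk; pose D : point := xdir (deviation 0 v).
have Dv : `|D| <= `|v| by rewrite (le_trans (norm_xdir _))// norm_deviation0.
have ballq s : 0 <= s <= 1 -> ball e0 r (q + s *: D).
  move=> /andP[s0 s1]; move: bq; rewrite -!ball_normE/= => bq.
  rewrite opprD addrA (le_lt_trans (ler_normB _ _))// [ltRHS]splitr ltrD//.
  rewrite normrZ ger0_norm// (le_lt_trans _ bz)// (le_trans _ Dv)//.
  by rewrite ler_piMl.
have bq0 : ball e0 r q.
  by have := ballq 0; rewrite scale0r addr0; apply; rewrite lexx ler01.
have bq1 : ball e0 r (q + D).
  by have := ballq 1; rewrite scale1r; apply; rewrite lexx ler01.
have [t t01] := lag_mean_value q v; rewrite -/D => mv.
have [t0 t1] := andP t01.
have bqt : ball e0 r (q + t *: D) by apply: ballq; rewrite !ltW.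
have [estA _ _] := est _ _ bqt bq0; have [_ estc estl] := est _ _ bq1 bq0.
pose s (i : 'I_(m k)) := con G i q - con G i (q + D).
pose g (i : 'I_(m k)) := ((gradg G i (pw p k) (submxcol x k))^T *m v) 0 0.
have dgE (i : 'I_(m k)) : 'd (con G i) e0 D = g i by exact: diff_con.
have conqD (i : 'I_(m k)) : con G i (q + D) = constr G i (z, pw q.1 k).
  rewrite /con /= addr0; congr (constr G i (_, _)).
  by rewrite submxcolD submxcol_deviation /v addrC subrK.
have slackq (i : 'I_(m k)) : (num_eq G k <= i)%N ->
    lamk i 0 * s i = lamk i 0 * (pu q.1 k i 0 - constr G i (z, pw q.1 k)).
  move=> i_ineq; have [_ /(_ i_ineq)[_ _ cs]] := gE i.
  rewrite /s conqD /con -/xk.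
  have -> : lamk i 0 * (constr G i (xk, pw q.1 k) - constr G i (z, pw q.1 k)) =
    lamk i 0 * (constr G i (xk, pw q.1 k) - pu q.1 k i 0) +
    lamk i 0 * (pu q.1 k i 0 - constr G i (z, pw q.1 k)) by ring.
  by rewrite cs add0r.
have s_eq (i : 'I_(m k)) : (i < num_eq G k)%N -> s i = 0.
  move=> i_eq; rewrite /s conqD /con -/xk.
  by rewrite ((gE i).1 i_eq) ((fz i).1 i_eq) subrr.
have ls0 i : 0 <= lamk i 0 * s i.
  have [i_eq|i_ineq] := ltnP i (num_eq G k); first by rewrite s_eq// mulr0.
  have [_ /(_ i_ineq)[l0 _ _]] := gE i.
  by rewrite slackq// mulr_ge0// subr_ge0 ((fz i).2 i_ineq).
have lsJ i : i \in I1 G p x lam k -> 2 * kap * s i ^+ 2 <= lamk i 0 * s i.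
  rewrite inE => /orP[i_eq|/and3P[i_ineq l0 _]].
    by rewrite s_eq// expr0n/= !mulr0.
  have [_ /(_ i_ineq)[lq0 _ _]] := gE i.
  have /ltW lt := estl i l0.
  (* At the pair [(q, q)] the estimate says that the multiplier at [q] is positive; then [s i >= 0]
     follows from [ls0]. *)
  have [_ _ /(_ i l0)] := est _ _ bq0 bq0; rewrite subrr mulr0 => lq.
  have s0 : 0 <= s i by rewrite -(pmulr_rge0 _ lq).
  by rewrite expr2 mulrA ler_wpM2r.
have sg i : `|- s i - g i| <= eps * `|v|.
  have qD : q + D - q = D by rewrite addrC addKr.
  have := estc i; rewrite qD dgE /s opprB => /le_trans; apply.
  by rewrite ler_wpM2l// ltW.
pose hv := qform (H k k k) v.
have t01' : 0 <= eps <= 1 by rewrite (ltW eps0).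
have growth := second_order_growth k0 (normr_ge0 v) (ler0n R (n k)) t01 t01' epsM
  (fin v) sg ls0 lsJ.
have AE a : A k a q = pv q.1 k a 0.
  rewrite vE mxE -derive_xdir//.
(* By stationarity the gradient at [q] is [pv]; each of the [n k] coordinates then contributes an
   error of at most [|v| * (eps * (t * |v|))]. *)
have descent : t * hv - eps * t * (n k)%:R * `|v| ^+ 2 <=
    \sum_a v a 0 * A k a (q + t *: D) - \sum_a v a 0 * pv q.1 k a 0.
  have qE : hv = \sum_a v a 0 * (H k k k *m v) a 0.
    by rewrite /hv /qform -mulmxA mxE; apply: eq_bigr => a _; rewrite mxE.
  rewrite -sumrB qE mulr_sumr.
  have -> : eps * t * (n k)%:R * `|v| ^+ 2 = \sum_(a < n k) eps * t * `|v| ^+ 2.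
    by rewrite sumr_const card_ord -mulr_natr; ring.
  rewrite -sumrB; apply: ler_sum => a _.
  have qD : q + t *: D - q = t *: D by rewrite addrC addKr.
  have := estA a; rewrite qD AE linearZ/= diff_grad.
  move=> he.
  have he' : `|A k a (q + t *: D) - pv q.1 k a 0 - t * (H k k k *m v) a 0| <= eps * (t * `|v|).
    apply: le_trans he _; rewrite ler_wpM2l ?(ltW eps0)// normrZ ger0_norm ?(ltW t0)//.
    by rewrite ler_wpM2l// ltW.
  have hm : `|v a 0 * (A k a (q + t *: D) - pv q.1 k a 0 - t * (H k k k *m v) a 0)| <=
     `|v| * (eps * (t * `|v|)).
    by rewrite normrM ler_pM// mx_entry_le.
  move: hm; rewrite ler_norml => /andP[hm _].
  move: hm; rewrite expr2; clear; lra.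
have o1 := lag_objective q z; have o0 := lag_objective q xk.
have dev0 : q + xdir (deviation 0 (xk - xk)) = q.
  rewrite subrr (_ : deviation 0 0 = 0); last first.
    by apply/normr0_eq0/le_anti; rewrite normr_ge0 (le_trans (norm_deviation0 _)) ?normr0.
  by rewrite -[xdir 0]/(0 : point) addr0.
rewrite dev0 in o0; rewrite -/xk -/v -/D in o1.
have sumv : \sum_a v a 0 * pv q.1 k a 0 =
    \sum_a pv q.1 k a 0 * z a 0 - \sum_a pv q.1 k a 0 * xk a 0.
  by rewrite -sumrB; apply: eq_bigr => a _; rewrite /v mxE [in X in _ + X]mxE; ring.
have suml : \sum_i lamk i 0 * s i =
    \sum_i lamk i 0 * constr G i (xk, pw q.1 k) -
    \sum_i lamk i 0 * constr G i (z, pw q.1 k).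
  by rewrite -sumrB; apply: eq_bigr => i _; rewrite /s conqD -mulrBr.
move: growth descent; rewrite -/hv suml sumv -mv o1 o0 -/lamk.
clear; lra.
Qed.

End LocalMin.

Theorem theorem3p2 (R : realType) (N : nat) (n m d : 'I_N -> nat)
    (G : nep R n m d)
    (p : blockvec R m * blockvec R n * blockvec R d)
    (x : blockvec R n) (lam : blockvec R m)
    (B : forall k, 'M[R]_(n k, n k - #|I1 G p x lam k|)) :
  S_KKT G p (x, lam) ->
  (forall k, LICQ G p x lam k) ->
  (forall k, is_basis_matrix (B k)) ->
  (forall k, SSOSC G p x lam k) ->
  (exists alpha : 'I_N -> 'I_N -> R,
    [/\ forall i j, j != i -> 0 < alpha i j,
        forall i, \sum_(j | j != i) alpha i j = 1
      & forall i k, i != k ->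
        forall y, critM G p x lam k y -> y != 0 ->
        let H := hessL G p x lam in
        let A := crossA G p x lam in
        0 < qform
          (H k k k - (4 * alpha i k * alpha k i)^-1 *:
             ((A i k)^T *m B i *m invmx ((B i)^T *m H i i i *m B i)
                *m (B i)^T *m A i k)) y]) ->
  lipschitz_localization (S_KKT G) p (x, lam) /\
  \forall q \near (p, (x, lam)), S_KKT G q.1 q.2 -> local_nash G q.1 q.2.1.
Proof.
move=> kkt licq basisB ssosc [alpha [alpha_gt0 alpha_sum dominance]]; split.
  exact: (kkt_lipschitz kkt licq basisB ssosc alpha_gt0 alpha_sum dominance).
have : \forall q \near (p, (x, lam)), forall k, S_KKT G q.1 q.2 ->
    local_minimizer (feasible G q.1 k) (objective G q.1 q.2.1 (k := k))
      (submxcol q.2.1 k).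
  apply: (@filter_forall _ _ _ (nbhs (p, (x, lam))) (nbhs_filter _)) => k.
  exact: (kkt_local_minimizer (ssosc k)).
by apply: filterS => q qmin kktq k; exact: qmin.
Qed.
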